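(* Let $\mathcal G=(\mathcal V,\mathcal E)$ be a bipartite graph and $\mathcal A$ a finite alphabet. Let $Gr\subset Aut(\mathcal G)$ be a subgroup, $X\subset\mathcal A^{\mathcal V}$ a $Gr$-invariant n.n.constraint space, and $X_a$ a strong config-fold of $X$ for some $a\in\mathcal A$. Then the quotient vector space $\mathbf M^{Gr}_X/\mathbf G^{Gr}_X$ is isomorphic to $\mathbf M^{Gr}_{X_a}/\mathbf G^{Gr}_{X_a}$.
   Context: Graphs: a graph $\mathcal G=(\mathcal V,\mathcal E)$ is a countable, locally finite, undirected graph without self-loops or multiple edges; $\sim$ denotes adjacency, $d_{\mathcal G}$ graph distance. For $F\subset\mathcal V$, $\partial F=\{u\in\mathcal V\setminus F: u\sim v\text{ for some }v\in F\}$, and $D_n(v)=\{w: d_{\mathcal G}(v,w)\le n\}$. A clique is a finite set of pairwise adjacent vertices (single vertices included). $Aut(\mathcal G)$ is the group of adjacency-preserving bijections of $\mathcal V$ (in both directions). Configurations: $\mathcal A^{\mathcal V}$ has the product topology, patterns are elements of $\mathcal A^F$, $F\subset \mathcal V$. For closed $X\subset\mathcal A^{\mathcal V}$, $\mathcal L_F(X)=\{x|_F:x\in X\}$ and $\mathcal L(X)=\bigcup_{F\text{ finite}}\mathcal L_F(X)$. $\langle a,c\rangle_{\{v,w\}}$ is the pattern with value $a$ at $v$ and $c$ at $w$; $b^F$ is the pattern on $F$ constantly $b$. An n.n.constraint space is a set of the form $\{x\in\mathcal A^{\mathcal V}:\text{ no pattern from }\mathcal F\text{ appears in }x\}$ where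 $\mathcal F$ is a set of patterns on cliques. Group action: for $g\in Aut(\mathcal G)$, $(gx)_v=x_{g^{-1}v}$, and for $\alpha\in\mathcal A^F$, $g\alpha\in\mathcal A^{gF}$ is $(g\alpha)_{gv}=\alpha_v$. $X$ is $Gr$-invariant if $gX=X$ for all $g\in Gr$. On interactions $gV(\alpha)=V(g^{-1}\alpha)$; $V$ is $Gr$-invariant if $gV=V$ for all $g\in Gr$. Cocycles: $\Delta_X=\{(x,y)\in X\times X: x,y\text{ differ at finitely many sites}\}$. A $\Delta_X$-cocycle is $M:\Delta_X\to\mathbb R$ with $M(x,z)=M(x,y)+M(y,z)$ for $(x,y),(y,z)\in\Delta_X$. It is a Markov cocycle if $M(x,y)$ depends only on $x|_{F\cup\partial F}$ and $y|_{F\cup\partial F}$, where $F$ is the set of sites where $x$ and $y$ differ. It is $Gr$-invariant if $M(gx,gy)=M(x,y)$ for all $g\in Gr$. A nearest neighbour interaction on $X$ is $V:\mathcal L(X)\to\mathbb R$ vanishing on patterns on finite sets that are not cliques. The Gibbs cocycle with interaction $V$ is $M(x,y)=\sum_{A\subset\mathcal V\text{ finite}}\big(V(y|_A)-V(x|_A)\big)$. $\mathbf M^{Gr}_X$ is the real vector space (pointwise operations) of $Gr$-invariant Markov cocycles on $X$, and $\mathbf G^{Gr}_X\subset\mathbf M^{Gr}_X$ is the subspace of Gibbs cocycles on $X$ with $Gr$-invariant nearest neighbour interactions. Folding: let $X\subset\mathcal A^{\mathcal V}$ be an n.n.constraint space on bipartite $\mathcal G$, and $a,b\in\mathcal A$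 distinct. $a$ can be strongly config-folded into $b$ if for all edges $(v_1,v_2),(v_2,v_3)\in\mathcal E$ and all $c\in\mathcal A$, $\langle a,c\rangle_{\{v_1,v_2\}}\in\mathcal L_{\{v_1,v_2\}}(X)$ implies $\langle b,c\rangle_{\{v_1,v_2\}}\in\mathcal L_{\{v_1,v_2\}}(X)$, $\langle c,b\rangle_{\{v_2,v_3\}}\in\mathcal L_{\{v_2,v_3\}}(X)$ and $b^{\partial D_1(v_1)}\in\mathcal L_{\partial D_1(v_1)}(X)$. In that case (for some such $b$) $X_a:=X\cap(\mathcal A\setminus\{a\})^{\mathcal V}$ is called a strong config-fold of $X$.
   Formalization: It is additionally assumed that X_a is nonempty whenever X is nonempty; this is automatic if every vertex has a neighbour, and without it the claim can fail when an isolated vertex is forced to carry a. *)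

(* Defs.v *)
From HB Require Import structures.
From mathcomp Require Import all_boot all_order all_algebra generic_quotient.
From mathcomp Require Import ring_quotient finmap.
From mathcomp Require Import all_classical all_reals.

Set Implicit Arguments.
Unset Strict Implicit.
Unset Printing Implicit Defensive.

Import Order.TTheory GRing.Theory Num.Theory.
Local Open Scope classical_set_scope.
Local Open Scope ring_scope.

Record graph (V : countType) := Graph {
  adj :> rel V;
  adj_sym : symmetric adj;
  adj_irr : irreflexive adj;
  adj_locally_finite : forall v, finite_set [set w | adj v w] }.

Section Graphs.
Variables (V : countType) (G : graph V).

Definition boundary (F : set V) : set V :=
  [set u | ~ F u /\ exists2 v, F v & G u v].

Definition ball (n : nat) (v : V) : set V :=
  [set w | exists s, [/\ path G v s, last v s = w & (size s <= n)%N]].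

Definition clique (F : set V) : Prop :=
  finite_set F /\ {in F &, forall u v, u != v -> G u v}.

Definition bipartite : Prop :=
  exists c : V -> bool, forall u v, G u v -> c u != c v.

Record Aut := MkAut {
  aut_fun :> V -> V;
  aut_inv : V -> V;
  aut_funK : cancel aut_fun aut_inv;
  aut_invK : cancel aut_inv aut_fun;
  aut_adj : forall u v, G (aut_fun u) (aut_fun v) = G u v }.

HB.instance Definition _ := gen_eqMixin Aut.
HB.instance Definition _ := gen_choiceMixin Aut.

Lemma aut_ext (g h : Aut) : g =1 h -> g = h.
Proof.
case: g h => [f f' fK f'K fG] [k k' kK k'K kG] /= /funext fk.
subst k; have fk' : f' = k' by apply/funext => v; rewrite -{1}[v]k'K fK.
subst k'; congr MkAut; exact: Prop_irrelevance.
Qed.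

Definition aut_one : Aut :=
  @MkAut id id (fun=> erefl) (fun=> erefl) (fun _ _ => erefl).

Lemma aut_inv_adj (g : Aut) u v : G (aut_inv g u) (aut_inv g v) = G u v.
Proof. by rewrite -(aut_adj g) !aut_invK. Qed.

Definition aut_opp (g : Aut) : Aut :=
  MkAut (aut_invK g) (aut_funK g) (aut_inv_adj g).

Lemma aut_comp_adj (g h : Aut) u v : G ((g \o h) u) ((g \o h) v) = G u v.
Proof. by rewrite /= !aut_adj. Qed.

Definition aut_mul (g h : Aut) : Aut :=
  MkAut (can_comp (aut_funK g) (aut_funK h)) (can_comp (aut_invK h) (aut_invK g))
    (aut_comp_adj g h).

Lemma aut_mulA : associative aut_mul.
Proof. by move=> g h k; apply: aut_ext. Qed.
Lemma aut_mul1 : left_id aut_one aut_mul.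
Proof. by move=> g; apply: aut_ext. Qed.
Lemma aut_mulr1 : right_id aut_one aut_mul.
Proof. by move=> g; apply: aut_ext. Qed.
Lemma aut_mulV : left_inverse aut_one aut_opp aut_mul.
Proof. by move=> g; apply: aut_ext => v; exact: aut_funK. Qed.
Lemma aut_mulrV : right_inverse aut_one aut_opp aut_mul.
Proof. by move=> g; apply: aut_ext => v; exact: aut_invK. Qed.

HB.instance Definition _ :=
  isGroup.Build Aut aut_mulA aut_mul1 aut_mulr1 aut_mulV aut_mulrV.

End Graphs.

(* With T := A this is the action on configurations; with T := option A it is
   the action on patterns, and it maps patterns on F to patterns on g F. *)
Definition act (V : countType) (G : graph V) (T : Type) (g : Aut G)
  (x : V -> T) : V -> T := fun v => x ((g^-1)%g v).

(* A pattern on F is a partial function V -> option A with domain F. *)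
Definition pattern (V A : Type) := V -> option A.

Section Patterns.
Variables (V : countType) (A : finType) (G : graph V).
Implicit Types (X : set (V -> A)) (F : set V) (x : V -> A) (al : pattern V A).

Definition dom al : set V := [set v | al v].

Definition restr x F : pattern V A :=
  fun v => if v \in F then Some (x v) else None.

Definition language_on X F : set (pattern V A) := [set restr x F | x in X].

Definition language X : set (pattern V A) :=
  \bigcup_(F in [set F | finite_set F]) language_on X F.

Definition pair_pattern (v w : V) (a c : A) : pattern V A :=
  fun u => if u == v then Some a else if u == w then Some c else None.

Definition const_pattern (b : A) F : pattern V A := restr (fun=> b) F.

Definition nn_constraint_space X : Prop :=
  exists2 forbidden : set (pattern V A),
    (forall al, forbidden al -> clique G (dom al)) &
    X = [set x | forall al, forbidden al -> restr x (dom al) <> al].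

Definition invariant_space (Gr : {pred Aut G}) X : Prop :=
  forall g, g \in Gr -> act g @` X = X.

Definition strongly_config_foldable X (a b : A) : Prop :=
  a != b /\
  forall v1 v2 v3 (c : A), G v1 v2 -> G v2 v3 ->
    language_on X [set v1; v2] (pair_pattern v1 v2 a c) ->
    [/\ language_on X [set v1; v2] (pair_pattern v1 v2 b c),
        language_on X [set v2; v3] (pair_pattern v2 v3 c b) &
        language_on X (boundary G (ball G 1 v1))
          (const_pattern b (boundary G (ball G 1 v1)))].

Definition config_fold X (a : A) : set (V -> A) :=
  X `&` [set x | forall v, x v != a].

Definition is_strong_config_fold X (a : A) (Xa : set (V -> A)) : Prop :=
  (exists b, strongly_config_foldable X a b) /\ Xa = config_fold X a.

Definition diff_sites (p : (V -> A) * (V -> A)) : set V :=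
  [set v | p.1 v != p.2 v].

Definition delta X : set ((V -> A) * (V -> A)) :=
  [set p | [/\ X p.1, X p.2 & finite_set (diff_sites p)]].

End Patterns.

Section Cocycles.
Variables (R : realType) (V : countType) (A : finType) (G : graph V).
Variables (Gr : {pred Aut G}) (X : set (V -> A)).

Definition is_cocycle (M : delta X -> R) : Prop :=
  forall xy yz xz : delta X,
    (\val xy).2 = (\val yz).1 -> (\val xz).1 = (\val xy).1 ->
    (\val xz).2 = (\val yz).2 -> M xz = M xy + M yz.

(* Equality of these patterns includes equality of their domains nbh p and
   nbh q, hence p and q differ at the same sites. *)
Definition is_markov (M : delta X -> R) : Prop :=
  let nbh (p : delta X) :=
    diff_sites (\val p) `|` boundary G (diff_sites (\val p)) in
  forall p q : delta X,
    restr (\val p).1 (nbh p) = restr (\val q).1 (nbh q) ->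
    restr (\val p).2 (nbh p) = restr (\val q).2 (nbh q) ->
    M p = M q.

Definition is_invariant_cocycle (M : delta X -> R) : Prop :=
  forall g, g \in Gr -> forall p q : delta X,
    (\val q).1 = act g (\val p).1 -> (\val q).2 = act g (\val p).2 -> M q = M p.

Definition markov_cocycles : {pred delta X -> R^o} :=
  [pred M | `[< [/\ is_cocycle M, is_markov M & is_invariant_cocycle M] >]].

Local Notation interaction := (language X -> R^o).

Definition nearest_neighbour (W : interaction) : Prop :=
  forall al : language X, ~ clique G (dom (\val al)) -> W al = 0.

Definition invariant_interaction (W : interaction) : Prop :=
  forall g, g \in Gr -> forall al be : language X,
    \val be = act (g^-1)%g (\val al) -> W be = W al.

Lemma restr_in_language (x : X) (F : {fset V}) :
  restr (\val x) [set` F] \in language X.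
Proof.
apply/mem_set; exists [set` F]; first exact: finite_fset.
by exists (\val x) => //; exact: set_valP.
Qed.

Definition restrL (x : X) (F : {fset V}) : language X :=
  exist _ (restr (\val x) [set` F]) (restr_in_language x F).

Lemma delta_fst_in (p : delta X) : (\val p).1 \in X.
Proof. by apply/mem_set; case: (set_valP p). Qed.
Lemma delta_snd_in (p : delta X) : (\val p).2 \in X.
Proof. by apply/mem_set; case: (set_valP p). Qed.

Definition delta_fst (p : delta X) : X := exist _ (\val p).1 (delta_fst_in p).
Definition delta_snd (p : delta X) : X := exist _ (\val p).2 (delta_snd_in p).

(* This finitely supported sum is 0 by convention when infinitely many terms
   are nonzero; gibbs_finite_support below excludes that case for
   nearest neighbour interactions. *)
Definition gibbs_cocycle (W : interaction) : delta X -> R^o := fun p =>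
  \sum_(F \in [set: {fset V}])
    (W (restrL (delta_snd p) F) - W (restrL (delta_fst p) F)).

Definition gibbs_cocycles : {pred delta X -> R^o} :=
  [pred M | `[< exists W : interaction,
    [/\ nearest_neighbour W, invariant_interaction W & M = gibbs_cocycle W] >]].

Lemma markov_cocycles_submod : submod_closed markov_cocycles.
Proof.
split; first by apply/asboolP; split=> [xy yz xz *||]; rewrite ?addr0.
move=> k M N /asboolP[cM mM iM] /asboolP[cN mN iN]; apply/asboolP; split.
- move=> xy yz xz e1 e2 e3; rewrite /= !fctE /= (cM _ _ _ e1 e2 e3).
  by rewrite (cN _ _ _ e1 e2 e3) scalerDr addrACA.
- by move=> p q e1 e2; rewrite !fctE /= (mM _ _ e1 e2) (mN _ _ e1 e2).
- move=> g gGr p q e1 e2.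
  by rewrite !fctE /= (iM _ gGr _ _ e1 e2) (iN _ gGr _ _ e1 e2).
Qed.

HB.instance Definition _ :=
  GRing.isSubmodClosed.Build R (delta X -> R^o) markov_cocycles
    markov_cocycles_submod.

Lemma dom_restr (x : V -> A) (F : set V) : dom (restr x F) = F.
Proof.
apply/seteqP; split=> v; rewrite /dom/restr /=; first by case: ifP => // /set_mem.
by move=> /mem_set ->.
Qed.

Lemma restr_eq (x y : V -> A) (F : set V) :
  restr x F = restr y F <-> (forall v, F v -> x v = y v).
Proof.
split=> [e v Fv|e].
  by have := congr1 (@^~ v) e; rewrite /restr mem_set// => -[].
by apply/funext => v; rewrite /restr; case: ifP => // /set_mem /e ->.
Qed.

Lemma gibbs_support (W : interaction) (p : delta X) (F : {fset V}) :
  nearest_neighbour W ->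
  W (restrL (delta_snd p) F) - W (restrL (delta_fst p) F) != 0 ->
  [set` F] `<=` diff_sites (\val p) `|` boundary G (diff_sites (\val p)).
Proof.
move=> nnW Wne.
have cF : clique G [set` F].
  apply: contrapT => ncF; move/eqP: Wne; apply.
  by rewrite !nnW ?subrr //= dom_restr.
have [v Fv pv] : exists2 v, [set` F] v & diff_sites (\val p) v.
  apply: contrapT => nF; move/eqP: Wne; apply; apply/eqP; rewrite subr_eq0.
  apply/eqP; congr W; apply/val_inj/restr_eq => v Fv; apply/esym/eqP.
  by apply/negPn/negP => ne; apply: nF; exists v.
move=> u Fu; have [pu|pu] := pselect (diff_sites (\val p) u); [by left|right].
split=> //; exists v => //; apply: cF.2; rewrite ?inE //.
by apply/eqP => uv; apply: pu; rewrite uv.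
Qed.

Lemma finite_boundary (F : set V) : finite_set F -> finite_set (boundary G F).
Proof.
move=> fF; apply: (@sub_finite_set _ _ (\bigcup_(v in F) [set w | G v w])).
  by move=> u [_ [v Fv uv]]; exists v => //=; rewrite adj_sym.
by apply: bigcup_finite => // v _; exact: adj_locally_finite.
Qed.

Lemma gibbs_finite_support (W : interaction) (p : delta X) :
  nearest_neighbour W ->
  finite_set [set F | W (restrL (delta_snd p) F)
                      - W (restrL (delta_fst p) F) != 0].
Proof.
move=> nnW.
set S := diff_sites (\val p) `|` boundary G (diff_sites (\val p)).
have fS : finite_set S.
  have [_ _ fp] := set_valP p.
  by rewrite finite_setU; split=> //; exact: finite_boundary.
apply: (@sub_finite_set _ _ [set` fpowerset (fset_set S)]).
  move=> F /= /(gibbs_support nnW) FS; rewrite fpowersetE; apply/fsubsetP => v.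
  by move=> /FS Sv; rewrite in_fset_set // inE.
exact: finite_fset.
Qed.

Lemma gibbs_cocycleE (W : interaction) (p : delta X) (D : {fset {fset V}}) :
  (forall F, W (restrL (delta_snd p) F) - W (restrL (delta_fst p) F) != 0 ->
     F \in D) ->
  gibbs_cocycle W p =
  \sum_(F <- D) (W (restrL (delta_snd p) F) - W (restrL (delta_fst p) F)).
Proof.
move=> WD; rewrite /gibbs_cocycle.
rewrite -(@fsbig_widen _ _ _ _ [set` D] setT) //=.
  by rewrite fsbig_finite ?set_fsetK //; exact: finite_fset.
move=> F [_ /= nDF]; apply/eqP/negPn/negP => /WD; exact: nDF.
Qed.

Lemma gibbs_cocycles_submod : submod_closed gibbs_cocycles.
Proof.
split.
  apply/asboolP; exists 0; split=> //; apply/funext => p.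
  by rewrite /gibbs_cocycle fsbig1 // => F _; exact: subrr.
move=> k _ _ /asboolP[W [nW iW ->]] /asboolP[U [nU iU ->]].
apply/asboolP; exists (k *: W + U); split.
- by move=> al nal; rewrite !fctE nW // nU // scaler0 addr0.
- by move=> g gGr al be e; rewrite !fctE (iW _ gGr _ _ e) (iU _ gGr _ _ e).
apply/funext => p.
have fW := gibbs_finite_support p nW.
have fU := gibbs_finite_support p nU.
pose D := (fset_set [set F | W (restrL (delta_snd p) F)
                      - W (restrL (delta_fst p) F) != 0] `|`
  fset_set [set F | U (restrL (delta_snd p) F)
                      - U (restrL (delta_fst p) F) != 0])%fset.
have sumE F : (k *: W + U) (restrL (delta_snd p) F)
      - (k *: W + U) (restrL (delta_fst p) F) =
    k *: (W (restrL (delta_snd p) F) - W (restrL (delta_fst p) F))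
      + (U (restrL (delta_snd p) F) - U (restrL (delta_fst p) F)).
  by rewrite scalerBr addrACA -opprD.
transitivity (k *: gibbs_cocycle W p + gibbs_cocycle U p); first by [].
have DW F : W (restrL (delta_snd p) F) - W (restrL (delta_fst p) F) != 0 ->
    F \in D.
  by move=> hF; rewrite in_fsetU !in_fset_set // mem_set.
have DU F : U (restrL (delta_snd p) F) - U (restrL (delta_fst p) F) != 0 ->
    F \in D.
  by move=> hF; rewrite in_fsetU !in_fset_set // orbC mem_set.
have DWU F : (k *: W + U) (restrL (delta_snd p) F)
    - (k *: W + U) (restrL (delta_fst p) F) != 0 -> F \in D.
  rewrite sumE; have [->|/DW //] :=
    eqVneq (W (restrL (delta_snd p) F) - W (restrL (delta_fst p) F)) 0.
  by rewrite scaler0 add0r => /DU.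
rewrite (gibbs_cocycleE DW) (gibbs_cocycleE DU) (gibbs_cocycleE DWU).
by rewrite scaler_sumr -big_split /=; apply: eq_bigr => F _; rewrite sumE.
Qed.

HB.instance Definition _ :=
  GRing.isSubmodClosed.Build R (delta X -> R^o) gibbs_cocycles
    gibbs_cocycles_submod.

Lemma act_restr (g : Aut G) (x : V -> A) (F : set V) :
  act g (restr x F) = restr (act g x) (g @` F).
Proof.
apply/funext => v; rewrite /act /restr; congr (if _ then _ else _).
apply/idP/idP => /set_mem h; apply/mem_set.
  by exists ((g^-1)%g v) => //; exact: aut_invK.
by case: h => u Fu <-; rewrite /= (aut_funK g).
Qed.

Lemma gibbs_sub_markov : {subset gibbs_cocycles <= markov_cocycles}.
Proof.
move=> _ /asboolP[W [nW iW ->]]; apply/asboolP; split.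
- move=> xy yz xz e1 e2 e3.
  have E1 : delta_snd xy = delta_fst yz by apply/val_inj.
  have E2 : delta_fst xz = delta_fst xy by apply/val_inj.
  have E3 : delta_snd xz = delta_snd yz by apply/val_inj.
  have f1 := gibbs_finite_support xy nW.
  have f2 := gibbs_finite_support yz nW.
  pose D := (fset_set [set F | W (restrL (delta_snd xy) F)
                      - W (restrL (delta_fst xy) F) != 0] `|`
    fset_set [set F | W (restrL (delta_snd yz) F)
                      - W (restrL (delta_fst yz) F) != 0])%fset.
  have D1 F : W (restrL (delta_snd xy) F) - W (restrL (delta_fst xy) F) != 0 ->
      F \in D.
    by move=> hF; rewrite in_fsetU !in_fset_set // mem_set.
  have D2 F : W (restrL (delta_snd yz) F) - W (restrL (delta_fst yz) F) != 0 ->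
      F \in D.
    by move=> hF; rewrite in_fsetU !in_fset_set // orbC mem_set.
  have sumE F : W (restrL (delta_snd xz) F) - W (restrL (delta_fst xz) F) =
      (W (restrL (delta_snd xy) F) - W (restrL (delta_fst xy) F))
      + (W (restrL (delta_snd yz) F) - W (restrL (delta_fst yz) F)).
    by rewrite E2 E3 -E1 [RHS]addrC addrA subrK.
  have D3 F : W (restrL (delta_snd xz) F) - W (restrL (delta_fst xz) F) != 0 ->
      F \in D.
    rewrite sumE; have [->|/D1 //] :=
      eqVneq (W (restrL (delta_snd xy) F) - W (restrL (delta_fst xy) F)) 0.
    by rewrite add0r => /D2.
  rewrite (gibbs_cocycleE D1) (gibbs_cocycleE D2) (gibbs_cocycleE D3).
  by rewrite -big_split /=; apply: eq_bigr => F _; rewrite sumE.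
- move=> /= p q e1 e2; rewrite /gibbs_cocycle; apply: eq_fsbigr => F _.
  set NP := _ `|` _ in e1 e2; set NQ := _ `|` _ in e1 e2.
  have NE : NP = NQ by rewrite -(dom_restr (\val p).1 NP) e1 dom_restr.
  rewrite -NE in e1 e2; move/restr_eq : e1 => e1; move/restr_eq : e2 => e2.
  have key : [set` F] `<=` NP ->
      W (restrL (delta_snd p) F) - W (restrL (delta_fst p) F) =
      W (restrL (delta_snd q) F) - W (restrL (delta_fst q) F).
    move=> FN.
    have -> : restrL (delta_snd p) F = restrL (delta_snd q) F.
      by apply/val_inj/restr_eq => v /FN; exact: e2.
    have -> // : restrL (delta_fst p) F = restrL (delta_fst q) F.
    by apply/val_inj/restr_eq => v /FN; exact: e1.
  have [/eqP p0|pn] := boolP (W (restrL (delta_snd p) F)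
      - W (restrL (delta_fst p) F) == 0); last first.
    by apply: key; exact: gibbs_support nW pn.
  have [/eqP q0|qn] := boolP (W (restrL (delta_snd q) F)
      - W (restrL (delta_fst q) F) == 0); first by rewrite p0 q0.
  by apply: key; rewrite NE; exact: gibbs_support nW qn.
- move=> g gGr p q e1 e2; rewrite /gibbs_cocycle.
  pose h (F : {fset V}) := [fset g v | v in F]%fset.
  pose h' (F : {fset V}) := [fset aut_inv g v | v in F]%fset.
  have gK := aut_funK g; have gVK := aut_invK g.
  have hbij : bijective h.
    exists h' => F; apply/fsetP => v; apply/imfsetP/idP => /=.
    + by case=> u /imfsetP[w /= wF ->] ->; rewrite gK.
    + by move=> vF; exists (g v); rewrite ?gK //; exact: in_imfset.
    + by case=> u /imfsetP[w /= wF ->] ->; rewrite gVK.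
    + by move=> vF; exists (aut_inv g v); rewrite ?gVK //; exact: in_imfset.
  rewrite (reindex_fsbigT h) //; apply: eq_fsbigr => F _.
  have hF : [set` h F] = g @` [set` F].
    apply/seteqP; split=> v /=; first by move=> /imfsetP[u /= uF ->]; exists u.
    by case=> u uF <-; exact: in_imfset.
  have key (x y : X) : \val y = act g (\val x) ->
      W (restrL y (h F)) = W (restrL x F).
    move=> e; apply/esym/(iW _ gGr) => /=; rewrite hF e -act_restr.
    by apply/funext => v; rewrite /act /= gK.
  by rewrite !(key (delta_snd p) (delta_snd q), key (delta_fst p) (delta_fst q)).
Qed.

End Cocycles.

Arguments markov_cocycles R {V A G} Gr X _.
Arguments gibbs_cocycles R {V A G} Gr X _.

(* The library's {quot I} takes a zmodClosed I, which submodClosed does not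
   inherit from, and only has an additive group structure: it is extended here
   to an R-module structure. *)
Section QuotientModule.
Variables (R : pzRingType) (M : lmodType R) (U : submodClosed M).
Local Open Scope quotient_scope.

Definition submod_pred : {pred M} := fun x => x \in U.

Lemma submod_predB : zmod_closed submod_pred.
Proof.
split=> [|x y hx hy]; first exact: (rpred0 U).
by rewrite -scaleN1r; apply: (rpredD hx); exact: rpredZ.
Qed.

HB.instance Definition _ := GRing.isZmodClosed.Build M submod_pred submod_predB.

Definition quot_lmod : Type := Quotient.quot submod_pred.
HB.instance Definition _ := GRing.Zmodule.on quot_lmod.

Definition quot_scale (k : R) (x : quot_lmod) : quot_lmod :=
  \pi_(Quotient.quot submod_pred) (k *: repr x).

Lemma quot_pi_scale k (x : M) :
  quot_scale k (\pi_(Quotient.quot submod_pred) x) = \pi_(Quotient.quot submod_pred) (k *: x).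
Proof.
apply/eqP; rewrite /quot_scale -Quotient.idealrBE -scalerBr.
have : repr (\pi_(Quotient.quot submod_pred) x) - x \in submod_pred.
  by rewrite Quotient.idealrBE; apply/eqP; exact: reprK.
exact: (@rpredZ _ _ U).
Qed.

Lemma quot_pi_add (x y : M) :
  (\pi_(Quotient.quot submod_pred) x : quot_lmod) + \pi_(Quotient.quot submod_pred) y
  = \pi_(Quotient.quot submod_pred) (x + y).
Proof. exact/esym/Quotient.pi_add. Qed.

Lemma quot_piP (x : quot_lmod) :
  exists y, x = \pi_(Quotient.quot submod_pred) y.
Proof. by exists (repr (x : Quotient.quot submod_pred)); rewrite reprK. Qed.

Lemma quot_scalerA a b x : quot_scale a (quot_scale b x) = quot_scale (a * b) x.
Proof. by have [y ->] := quot_piP x; rewrite !quot_pi_scale scalerA. Qed.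
Lemma quot_scale1r : left_id 1 quot_scale.
Proof. by move=> x; have [y ->] := quot_piP x; rewrite quot_pi_scale scale1r. Qed.
Lemma quot_scalerDr : right_distributive quot_scale +%R.
Proof.
move=> k x y; have [u ->] := quot_piP x; have [v ->] := quot_piP y.
by rewrite quot_pi_add !quot_pi_scale quot_pi_add scalerDr.
Qed.
Lemma quot_scalerDl x : {morph quot_scale^~ x : a b / a + b}.
Proof.
move=> a b; have [y ->] := quot_piP x.
by rewrite !quot_pi_scale quot_pi_add scalerDl.
Qed.

HB.instance Definition _ := GRing.Zmodule_isLmodule.Build R quot_lmod
  quot_scalerA quot_scale1r quot_scalerDr quot_scalerDl.
End QuotientModule.

Section CocycleQuotient.
Variables (R : realType) (V : countType) (A : finType) (G : graph V).
Variables (Gr : {pred Aut G}) (X : set (V -> A)).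

Definition markov_space : Type :=
  {M : delta X -> R^o | M \in markov_cocycles R Gr X}.
HB.instance Definition _ := SubChoice.on markov_space.
HB.instance Definition _ :=
  [SubChoice_isSubLmodule of markov_space by <:].

(* By gibbs_sub_markov this contains every element of gibbs_cocycles. *)
Definition gibbs_space : {pred markov_space} :=
  [pred M | \val M \in gibbs_cocycles R Gr X].

Lemma gibbs_space_submod : submod_closed gibbs_space.
Proof.
split; first exact: (rpred0 (gibbs_cocycles R Gr X)).
move=> k M N hM hN; exact: (rpredD (rpredZ k hM) hN).
Qed.

HB.instance Definition _ :=
  GRing.isSubmodClosed.Build R markov_space gibbs_space gibbs_space_submod.

Definition markov_mod_gibbs : lmodType R := quot_lmod gibbs_space.
End CocycleQuotient.

Definition lmod_isomorphic (R : pzRingType) (M N : lmodType R) : Prop :=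
  exists f : {linear M -> N}, bijective f.

(* Main.v *)
From HB Require Import structures.
Require Import Defs.
From mathcomp Require Import all_boot all_order all_algebra finmap.
From mathcomp Require Import generic_quotient ring_quotient.
From mathcomp Require Import all_classical all_reals.
From mathcomp Require Import lra.

(** The isomorphism is induced by restricting cocycles from [X] to the fold
    [Xa].

    Folding every site, that is, replacing each [a] by an allowed symbol chosen
    in a [Gr]-equivariant way, is a retraction [phi] of [X] onto [Xa]
    ([fold_all_in]) that acts site by site and commutes with [Gr].  Hence
    [M o phi] is an invariant Markov cocycle on [X] for every invariant Markov
    cocycle [M] on [Xa] ([cocycle_extend_markov]), so restriction is onto, and
    [M o phi] is Gibbs when [M] is, because interactions can be pulled back along
    [phi] as well ([cocycle_extend_gibbs]).  It remains to see that [M] is Gibbs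
    as soon as its restriction is; subtracting [M|Xa o phi], this amounts to: an
    invariant Markov cocycle [N] on [X] that vanishes on [Xa] is Gibbs
    ([gibbs_of_fold_zero]).

    Such an [N] is determined by the energies [energy v x = N(x, x')], where
    [x v = a] and [x'] is [x] folded at the single site [v]: any two
    configurations can be folded near their difference one site at a time, and
    then [N] vanishes ([cocycle_eq0]).  By the Markov property the energy depends
    only on [x] around [v].  Strong foldability is what makes it a sum of
    functions of single neighbours.  Indeed the neighbourhood pattern of [v] can be
    surrounded by [b]'s at distance two ([referenceP]).  In such a surrounding the
    neighbours of [v] are independent of one another: any mixture of admissible
    neighbour symbols is admissible, and replacing the symbol at one neighbour
    [w] changes the energy by an amount that depends only on [w] and the new
    symbol, since [G] is bipartite and nothing else around [w] varies
    ([energyE]).  So one-site and two-site terms suffice to build an interaction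
    whose Gibbs cocycle has the same energies as [N] ([gibbs_interaction_fold]).
    When both ends of an edge carry [a], the term of that edge has to serve the
    folding of either end; this is consistent because the two foldings commute
    ([edge_energy_sym]).  All choices are made from [Gr]-invariant data, whence the
    interaction is invariant ([fold_interaction_act]). *)

Set Implicit Arguments.
Unset Strict Implicit.
Unset Printing Implicit Defensive.

Import Order.TTheory GRing.Theory Num.Theory.
Local Open Scope classical_set_scope.
Local Open Scope ring_scope.

(** * Quotients of modules *)

Section QuotientIsomorphism.
Variables (R : pzRingType) (M : lmodType R) (U : submodClosed M).
Local Open Scope quotient_scope.

Definition quot_class (x : M) : quot_lmod U :=
  \pi_(Quotient.quot (submod_pred U)) x.

Lemma quot_class_eq x y : quot_class x = quot_class y <-> x - y \in U.
Proof.
have h := Quotient.idealrBE (submod_pred U) x y.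
by split=> [e|xyU]; [have := h; rewrite [RHS](introT eqP e) | apply/eqP; rewrite -h].
Qed.

Lemma quot_class_linear : linear quot_class.
Proof. by move=> k x y; rewrite /quot_class -quot_pi_add -quot_pi_scale. Qed.

Lemma quot_class_surj q : exists x, q = quot_class x.
Proof. exact: quot_piP. Qed.
End QuotientIsomorphism.

Lemma quot_lmod_isomorphic (R : pzRingType) (M M' : lmodType R)
    (U : submodClosed M) (U' : submodClosed M') (f : {linear M -> M'}) :
    (forall y, exists x, f x = y) -> (forall x, (f x \in U') = (x \in U)) ->
  lmod_isomorphic (quot_lmod U) (quot_lmod U').
Proof.
move=> f_surj f_sub.
have [rep repK] := choice (@quot_class_surj R M U).
pose F q := quot_class U' (f (rep q)).
have FE x : F (quot_class U x) = quot_class U' (f x).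
  by apply/quot_class_eq; rewrite -linearB f_sub; apply/quot_class_eq.
have F_linear : linear F.
  move=> k p q; rewrite {1}[p]repK {1}[q]repK -quot_class_linear FE linearP.
  exact: quot_class_linear.
pose L : {linear quot_lmod U -> quot_lmod U'} :=
  HB.pack F (GRing.isLinear.Build _ _ _ _ F F_linear).
have F_inj : injective F.
  move=> p q; have [x ->] := quot_class_surj p; have [y ->] := quot_class_surj q.
  rewrite !FE => /quot_class_eq; rewrite -linearB f_sub => xyU.
  exact/quot_class_eq.
have F_surj q : exists p, F p = q.
  have [y ->] := quot_class_surj q; have [x <-] := f_surj y.
  by exists (quot_class U x).
have [inv invK] := choice F_surj.
by exists L, inv => // p; apply: F_inj; rewrite invK.
Qed.

(** * Cocycles as functions of two configurations *)

Section PairValues.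
Variables (R : realType) (V : countType) (A : finType) (G : graph V).
Variable X : set (V -> A).
Implicit Types (x y z : V -> A) (S : {fset V}) (N : delta X -> R).

(** Cocycles live on a type of pairs with a proof of asymptoticity; the value 0
    off that type lets them be applied to any two configurations, so that the
    proofs stay out of the equations. *)
Definition pair_value N x y : R :=
  if pselect (delta X (x, y)) is left h then N (exist _ (x, y) (mem_set h)) else 0.

Lemma pair_value_delta N x y (h : delta X (x, y)) :
  pair_value N x y = N (exist _ (x, y) (mem_set h)).
Proof.
by rewrite /pair_value; case: pselect => // h'; congr N; apply: val_inj.
Qed.

Lemma pair_valueE N p : pair_value N (val p).1 (val p).2 = N p.
Proof.
have h : delta X ((val p).1, (val p).2).
  by rewrite -surjective_pairing; exact: set_valP.
rewrite (pair_value_delta N h); congr N; apply: val_inj => /=.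
by rewrite -surjective_pairing.
Qed.

Definition agree_off S x y := forall u, u \notin S -> x u = y u.

Lemma agree_off_sym S x y : agree_off S x y -> agree_off S y x.
Proof. by move=> h u /h. Qed.

Lemma agree_off_delta S x y : X x -> X y -> agree_off S x y -> delta X (x, y).
Proof.
move=> Xx Xy xy; split=> //; apply: (@sub_finite_set _ _ [set` S]) => //.
move=> u; rewrite /diff_sites /=; apply: contraNT => /xy ->; exact: eqxx.
Qed.

Lemma delta_agree_off x y : delta X (x, y) -> exists S, agree_off S x y.
Proof.
case=> _ _ fxy; exists (fset_set (diff_sites (x, y))) => u.
by rewrite in_fset_set// => /negP; rewrite inE /diff_sites /= => /negP/negPn/eqP.
Qed.

Lemma delta_trans x y z : delta X (x, y) -> delta X (y, z) -> delta X (x, z).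
Proof.
move=> xy yz; have [S xyS] := delta_agree_off xy.
have [T yzT] := delta_agree_off yz; have [Xx _ _] := xy; have [_ Xz _] := yz.
apply: (@agree_off_delta (S `|` T)%fset) => // u.
by rewrite in_fsetU negb_or => /andP[/xyS -> /yzT].
Qed.

Lemma delta_sym x y : delta X (x, y) -> delta X (y, x).
Proof.
move=> xy; have [S xyS] := delta_agree_off xy; have [Xx Xy _] := xy.
exact: agree_off_delta (agree_off_sym xyS).
Qed.

Section Properties.
Variable N : delta X -> R.
Hypotheses (cocycleN : is_cocycle N) (markovN : is_markov G N).

Lemma pair_value_trans x y z : delta X (x, y) -> delta X (y, z) ->
  pair_value N x z = pair_value N x y + pair_value N y z.
Proof.
move=> xy yz; rewrite (pair_value_delta N xy) (pair_value_delta N yz).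
by rewrite (pair_value_delta N (delta_trans xy yz)); exact: cocycleN.
Qed.

Lemma pair_value_refl x : X x -> pair_value N x x = 0.
Proof.
move=> Xx; have xx : delta X (x, x) by apply: (@agree_off_delta fset0).
by have := pair_value_trans xx xx; lra.
Qed.

Lemma pair_value_sym x y : delta X (x, y) ->
  pair_value N y x = - pair_value N x y.
Proof.
move=> xy; have [Xx _ _] := xy; apply/eqP; rewrite -addr_eq0 addrC.
by rewrite -pair_value_trans ?pair_value_refl//; exact: delta_sym.
Qed.

(** Working form of the Markov property: [S] is any finite set that contains the
    sites where the pairs differ, so that the set of differing sites need not
    be computed.  Agreement of [y] and [y'] on the boundary comes for free,
    because there they coincide with [x] and [x']. *)
Lemma pair_value_local S x y x' y' : X x -> X y -> X x' -> X y' ->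
  agree_off S x y -> agree_off S x' y' ->
  {in S, x =1 x'} -> {in S, y =1 y'} ->
  (forall u w, u \in S -> G u w -> x w = x' w) ->
  pair_value N x y = pair_value N x' y'.
Proof.
move=> Xx Xy Xx' Xy' xy xy' xx' yy' nbr.
have h := agree_off_delta Xx Xy xy; have h' := agree_off_delta Xx' Xy' xy'.
rewrite (pair_value_delta N h) (pair_value_delta N h').
have diffE : diff_sites (x, y) = diff_sites (x', y').
  rewrite /diff_sites /=; apply/seteqP; split=> u /=.
    by have [uS|/xy ->] := boolP (u \in S); rewrite ?eqxx // xx' // yy'.
  by have [uS|/xy' ->] := boolP (u \in S); rewrite ?eqxx // xx' // yy'.
set D := diff_sites (x, y) `|` boundary G (diff_sites (x, y)).
have DS u : D u -> u \in S \/ exists2 w, w \in S & G w u.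
  have sub w : diff_sites (x, y) w -> w \in S.
    by rewrite /diff_sites /=; apply: contraNT => /xy ->; exact: eqxx.
  by case=> [/sub|[_ [w /sub wS uw]]]; [left | right; exists w; rewrite // adj_sym].
apply: markovN => /=; rewrite -diffE; apply/restr_eq => u /DS.
  by case=> [/xx'//|[w wS wu]]; exact: nbr wS wu.
case=> [/yy'//|[w wS wu]]; have [/yy'//|uS] := boolP (u \in S).
by rewrite -xy// -xy'//; exact: nbr wS wu.
Qed.
End Properties.

Lemma pair_value_act (Gr : {pred Aut G}) N g x y :
  invariant_space Gr X -> is_invariant_cocycle Gr N -> g \in Gr ->
  delta X (x, y) -> pair_value N (act g x) (act g y) = pair_value N x y.
Proof.
move=> invX invN gGr xy; have [Xx Xy _] := xy.
have [S xyS] := delta_agree_off xy.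
have gxy : delta X (act g x, act g y).
  apply: (@agree_off_delta [fset g u | u in S]%fset).
  - by rewrite -(invX _ gGr); exists x.
  - by rewrite -(invX _ gGr); exists y.
  - move=> u uS; rewrite /act; apply: xyS; apply: contraNN uS => uS.
    by rewrite -[u](aut_invK g); exact: in_imfset.
by rewrite (pair_value_delta N xy) (pair_value_delta N gxy); exact: invN gGr _ _ _ _.
Qed.
End PairValues.

(** * Nearest neighbour constraints on a bipartite graph *)

Section Language.
Variables (V : countType) (A : finType) (G : graph V) (X : set (V -> A)).
Implicit Types (x y z : V -> A) (u v w : V) (c d : A).
Hypothesis bipG : bipartite G.

Definition occurs v c := exists2 x, X x & x v = c.
Definition occurs2 v w c d := exists x, [/\ X x, x v = c & x w = d].

Lemma adj_neq v w : G v w -> v != w.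
Proof. by move=> vw; apply/eqP => e; move: vw; rewrite e adj_irr. Qed.

Lemma bipartite_no_triangle u v w : G u v -> G u w -> G v w = false.
Proof.
have [col colP] := bipG => uv uw; apply/negP => /colP.
by move: (colP _ _ uv) (colP _ _ uw); case: (col u); case: (col v); case: (col w).
Qed.

Lemma restr_pair x v w c d : v != w ->
  restr x [set v; w] = pair_pattern v w c d <-> x v = c /\ x w = d.
Proof.
move=> vw; split=> [e|[xv xw]].
  have := congr1 (@^~ v) e; have := congr1 (@^~ w) e.
  rewrite /restr /pair_pattern !eqxx (eq_sym w) (negPf vw).
  rewrite !mem_set; try by [left|right].
  by move=> [->] [->].
apply/funext => u; rewrite /restr /pair_pattern.
have [->|uv] := eqVneq u v; first by rewrite mem_set ?xv//; left.
have [->|uw] := eqVneq u w; first by rewrite mem_set ?xw//; right.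
by rewrite memNset // => -[] /eqP; rewrite ?(negPf uv) ?(negPf uw).
Qed.

Lemma language_on_pair v w c d : v != w ->
  language_on X [set v; w] (pair_pattern v w c d) <-> occurs2 v w c d.
Proof.
move=> vw; split=> [[x Xx] /(restr_pair _ _ _ vw)[xv xw]|[x [Xx xv xw]]].
  by exists x.
by exists x => //; apply/restr_pair.
Qed.

Lemma occurs2C v w c d : occurs2 v w c d -> occurs2 w v d c.
Proof. by case=> x [Xx xv xw]; exists x. Qed.

Lemma occurs2_config x v w : X x -> occurs2 v w (x v) (x w).
Proof. by move=> Xx; exists x. Qed.

Lemma clique_bipartite (F : set V) : clique G F ->
  [\/ F = set0, exists v, F = [set v] |
      exists v w, G v w /\ F = [set v; w]].
Proof.
move=> [_ F_adj]; have {}F_adj u v : F u -> F v -> u != v -> G u v.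
  by move=> Fu Fv; apply: F_adj; rewrite inE.
have [[v Fv]|F0] := pselect (F !=set0); last first.
  by apply: Or31; apply/seteqP; split=> u // Fu; case: F0; exists u.
have [[w [Fw vw]]|Fv1] := pselect (exists w, F w /\ v != w); last first.
  apply: Or32; exists v; apply/seteqP; split=> [u Fu|_ -> //].
  by apply/eqP; rewrite eq_sym; apply/negPn/negP => vu; case: Fv1; exists u.
apply: Or33; exists v, w; split; first exact: F_adj.
apply/seteqP; split=> [u Fu|u [->|->]//].
have [->|uv] := eqVneq u v; [by left | right; apply/eqP/negPn/negP => uw].
have vu : G v u by apply: F_adj; rewrite // eq_sym.
have := bipartite_no_triangle vu (F_adj _ _ Fv Fw vw).
by rewrite F_adj.
Qed.

(** On a bipartite graph the cliques are the empty set, the sites and the edges.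
    The nonemptiness of [X] accounts for the empty clique: the empty pattern may
    be forbidden. *)
Lemma nn_constraint_glue x : nn_constraint_space G X -> X !=set0 ->
  (forall v, occurs v (x v)) ->
  (forall v w, G v w -> occurs2 v w (x v) (x w)) -> X x.
Proof.
move=> [forb forbP XE] X0 x1 x2; rewrite XE => al al_forb e.
have key : exists2 y, X y & restr y (dom al) = restr x (dom al).
  case: (clique_bipartite (forbP _ al_forb)) => [->|[v ->]|[v [w [vw ->]]]].
  - by have [y Xy] := X0; exists y => //; apply/restr_eq.
  - by have [y Xy yv] := x1 v; exists y => //; apply/restr_eq => _ ->.
  - have [y [Xy yv yw]] := x2 _ _ vw.
    by exists y => //; apply/restr_eq => _ [->|->].
have [y Xy yx] := key; move: Xy; rewrite XE => /(_ _ al_forb).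
by rewrite yx.
Qed.

Lemma act_aut (g : Aut G) x v : act g x (g v) = x v :> A.
Proof. by rewrite /act /= (aut_funK g). Qed.

Lemma invariant_act (Gr : {pred Aut G}) g x : invariant_space Gr X -> g \in Gr ->
  X (act g x) <-> X x.
Proof.
move=> invX gGr; split=> [|Xx]; last by rewrite -(invX _ gGr); exists x.
rewrite -{1}(invX _ gGr) => -[y Xy e]; suff <- : y = x by [].
by apply/funext => v; rewrite -(act_aut g y) -(act_aut g x) e.
Qed.
End Language.

(** * The folding map *)

Section Fold.
Variables (V : countType) (A : finType) (G : graph V) (X : set (V -> A)).
Variables (a b : A).
Implicit Types (x y z : V -> A) (u v w : V) (c d : A) (S : {pred V}).
Hypothesis bipG : bipartite G.
Hypothesis nnX : nn_constraint_space G X.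
Hypothesis foldX : strongly_config_foldable G X a b.
Hypothesis fold_nonempty : X !=set0 -> config_fold X a !=set0.

Let Xa := config_fold X a.

(** The three consequences of strong foldability at an edge.  In the last one,
    the boundary of the ball of radius one is the set of sites at distance two,
    because a neighbour of a neighbour of [v] is never a neighbour of [v]. *)
Lemma fold_edge v w c : G v w -> occurs2 X v w a c ->
  occurs2 X v w b c /\
  (forall u, G w u -> occurs2 X w u c b) /\
  exists2 z, X z & forall w u, G v w -> G w u -> u != v -> z u = b.
Proof.
have [_ foldP] := foldX => vw vwac; have [bc _ ring_b] := foldP v w v c vw
  (etrans (adj_sym G w v) vw) ((language_on_pair _ _ _ (adj_neq vw)).2 vwac).
split; first exact: (language_on_pair _ _ _ (adj_neq vw)).1 bc.
split=> [u wu|].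
  apply/(language_on_pair _ _ _ (adj_neq wu)).
  by have [] := foldP v w u c vw wu ((language_on_pair _ _ _ (adj_neq vw)).2 vwac).
have [z Xz /restr_eq zb] := ring_b; exists z => // w' u vw' w'u uv.
apply: zb; split.
  move=> [[|t [|t' s]] [/= vt tu // _]]; first by rewrite tu eqxx in uv.
  have := bipartite_no_triangle bipG vw' (andP vt).1.
  by rewrite tu w'u.
by exists w'; [exists [:: w']; rewrite /= vw' | rewrite adj_sym].
Qed.

(** The symbol that replaces [a].  At a site that allows [a] and has a
    neighbour this is [b]; at an isolated site foldability says nothing and [b]
    need not be allowed, so that another symbol may have to be taken.  The choice depends only on the set of
    symbols allowed at the site, hence is the same along [Gr]-orbits. *)
Definition fold_target v : A :=
  if `[< occurs X v b >] then b
  else odflt a [pick c | (c != a) && `[< occurs X v c >]].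

Lemma fold_target_adj v w : G v w -> occurs X v a -> fold_target v = b.
Proof.
move=> vw [x Xx xv]; rewrite /fold_target; case: asboolP => // -[].
have [|[y [Xy yv _]] _] := @fold_edge v w (x w) vw; first by exists x.
by exists y.
Qed.

Lemma fold_targetP v : occurs X v a -> fold_target v != a /\ occurs X v (fold_target v).
Proof.
have [aNb _] := foldX; move=> [x Xx xv]; rewrite /fold_target.
case: asboolP => [vb|_]; first by rewrite eq_sym.
case: pickP => [c /andP[? /asboolP ?]//|no].
have [|z [Xz /(_ v) zv]] := fold_nonempty; first by exists x.
by have := no (z v); rewrite zv /=; case: asboolP => // -[]; exists z.
Qed.

Definition fold_symbol v c := if c == a then fold_target v else c.

Definition fold S x v := if v \in S then fold_symbol v (x v) else x v.

Lemma fold_symbolN v c : c != a -> fold_symbol v c = c.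
Proof. by rewrite /fold_symbol => /negPf ->. Qed.

Lemma fold_symbol_neq v c : occurs X v c -> fold_symbol v c != a.
Proof.
move=> vc; rewrite /fold_symbol; case: (c =P a) => [ca|/eqP //].
by rewrite ca in vc; have [] := fold_targetP vc.
Qed.

Lemma fold_symbol_occurs v c : occurs X v c -> occurs X v (fold_symbol v c).
Proof.
move=> vc; rewrite /fold_symbol; case: (c =P a) => // ca.
by rewrite ca in vc; have [] := fold_targetP vc.
Qed.

Lemma fold_symbol_occurs2 v w c d : G v w -> occurs2 X v w c d ->
  occurs2 X v w (fold_symbol v c) d.
Proof.
move=> vw vwcd; rewrite /fold_symbol; case: (c =P a) => // ca; rewrite ca in vwcd.
have [x [Xx xv _]] := vwcd.
by rewrite (fold_target_adj vw); [have [] := fold_edge vw vwcd | exists x].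
Qed.

(** An edge whose two ends both carry [a] is folded one end at a time, the
    pattern with a single fold being again allowed. *)
Lemma fold_in S x : X x -> X (fold S x).
Proof.
move=> Xx; apply: (nn_constraint_glue bipG nnX); first by exists x.
  move=> v; have xv : occurs X v (x v) by exists x.
  by rewrite /fold; case: ifP => // _; exact: fold_symbol_occurs.
move=> v w vw; have xvw := occurs2_config v w Xx.
have wv : G w v by rewrite adj_sym.
have xvw' : occurs2 X v w (fold S x v) (x w).
  by rewrite /fold; case: ifP => // _; exact: fold_symbol_occurs2.
rewrite {2}/fold; case: ifP => // _; apply: occurs2C.
by apply: fold_symbol_occurs2 => //; exact: occurs2C.
Qed.

Lemma fold_all_in x : X x -> Xa (fold predT x).
Proof.
move=> Xx; split; first exact: fold_in.
by move=> v; apply: fold_symbol_neq; exists x.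
Qed.

Lemma fold_id S x : (forall v, x v != a) -> fold S x = x.
Proof.
by move=> xa; apply/funext => v; rewrite /fold fold_symbolN ?if_same.
Qed.

(** Default symbol at [w] next to an [a] at [v].  The symbol [b] would not do: it
    need not be allowed next to [a]. *)
Definition neighbour_symbol v w : A :=
  odflt a [pick c | `[< occurs2 X v w a c >]].

(** The ring of [b]'s at distance two frees the neighbours of [v] from the rest
    of the configuration. *)
Definition isolating v y : Prop :=
  [/\ X y, y v = a, forall w, G v w -> y w = neighbour_symbol v w &
      forall w u, G v w -> G w u -> u != v -> y u = b].

Definition reference v : V -> A := xget (fun=> a) [set y | isolating v y].

Lemma neighbour_symbolP x v w : X x -> x v = a ->
  occurs2 X v w a (neighbour_symbol v w).
Proof.
move=> Xx xv; rewrite /neighbour_symbol; case: pickP => [c /asboolP //|/(_ (x w))].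
by case: asboolP => // -[]; exists x.
Qed.

(** The configuration is glued from [a] at [v], the default symbols on its
    neighbours, and elsewhere any point of [X] with [b] at distance two. *)
Lemma referenceP x v : X x -> x v = a -> isolating v (reference v).
Proof.
move=> Xx xv; apply: xgetPex.
have [z Xz zb] : exists2 z, X z &
    forall w u, G v w -> G w u -> u != v -> z u = b.
  have [[w vw]|iso] := pselect (exists w, G v w); last first.
    by exists x => // w u vw; case: iso; exists w.
  by have [] := @fold_edge v w (x w) vw; [exists x | move=> _ []].
pose y u := if u == v then a else if G v u then neighbour_symbol v u else z u.
have yv : y v = a by rewrite /y eqxx.
have yw w : G v w -> y w = neighbour_symbol v w.
  by move=> vw; rewrite /y eq_sym (negPf (adj_neq vw)) vw.
have yz u : u != v -> ~~ G v u -> y u = z u.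
  by move=> /negPf uv /negPf vu; rewrite /y uv vu.
have vOK w : occurs2 X v w a (neighbour_symbol v w) := neighbour_symbolP w Xx xv.
have y1 u : occurs X u (y u).
  have [->|uv] := eqVneq u v; first by rewrite yv; exists x.
  have [vu|vu] := boolP (G v u); last by rewrite yz//; exists z.
  by rewrite yw//; have [t [? _ ?]] := vOK u; exists t.
exists y; split=> //; last first.
  move=> w u vw wu uv; rewrite yz ?zb//; first exact: zb vw wu uv.
  by apply/negP => vu; rewrite (bipartite_no_triangle bipG vw vu) in wu.
have edge_w w u : G v w -> G w u -> occurs2 X w u (y w) (y u).
  move=> vw wu; rewrite yw//; have [->|uv] := eqVneq u v.
    by rewrite yv; exact: occurs2C.
  have vu : ~~ G v u.
    by apply/negP => vu; rewrite (bipartite_no_triangle bipG vw vu) in wu.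
  rewrite yz// (zb _ _ vw wu uv).
  by have [_ [/(_ _ wu)]] := fold_edge vw (vOK w).
apply: (nn_constraint_glue bipG nnX) => //; first by exists x.
move=> u w uw; have wu : G w u by rewrite adj_sym.
have [e|uv] := eqVneq u v; first by subst u; exact/occurs2C/edge_w.
have [e|wv] := eqVneq w v; first by subst w; apply: edge_w.
have [vu|vu] := boolP (G v u); first exact: edge_w.
have [vw|vw] := boolP (G v w); first exact/occurs2C/edge_w.
by rewrite !yz//; exact: occurs2_config.
Qed.
End Fold.

(** All choices made above are functions of the local language of [X], which is
    the same at sites and edges of one [Gr]-orbit. *)

Section FoldInvariance.
Variables (V : countType) (A : finType) (G : graph V) (X : set (V -> A)).
Variables (a b : A) (Gr : {pred Aut G}) (g : Aut G).
Hypotheses (invX : invariant_space Gr X) (gGr : g \in Gr).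
Implicit Types (x y : V -> A) (v w : V).

Lemma occurs2_act v w c d : occurs2 X (g v) (g w) c d <-> occurs2 X v w c d.
Proof.
split=> -[x [Xx xv xw]].
  exists (act (g^-1)%g x); split; last 2 first.
  - by rewrite -xv /act invgK.
  - by rewrite -xw /act invgK.
  - apply/(invariant_act _ invX gGr); suff -> : act g (act (g^-1)%g x) = x by [].
    by apply/funext => u; rewrite /act invgK /= (aut_invK g).
exists (act g x); split; rewrite ?act_aut//; exact/(invariant_act _ invX gGr).
Qed.

Lemma occurs_act v c : occurs X (g v) c <-> occurs X v c.
Proof.
have occE u : occurs X u c <-> occurs2 X u u c c.
  by split=> [[x Xx xu]|[x [Xx xu _]]]; exists x.
by split=> /occE/occurs2_act/occE.
Qed.

Lemma fold_target_act v : fold_target X a b (g v) = fold_target X a b v.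
Proof.
have e c : `[< occurs X (g v) c >] = `[< occurs X v c >].
  exact/asbool_equiv_eq/occurs_act.
rewrite /fold_target e; case: ifP => // _; congr odflt; apply: eq_pick => c.
by rewrite e.
Qed.

Lemma neighbour_symbol_act v w :
  neighbour_symbol X a (g v) (g w) = neighbour_symbol X a v w.
Proof.
rewrite /neighbour_symbol; congr odflt; apply: eq_pick => c.
exact/asbool_equiv_eq/occurs2_act.
Qed.

Lemma fold_act (S S' : {pred V}) x : (forall v, (g v \in S') = (v \in S)) ->
  fold X a b S' (act g x) = act g (fold X a b S x).
Proof.
move=> SS'; apply/funext => u; rewrite -[u](aut_invK g); move: (aut_inv g u) => v.
by rewrite act_aut /fold SS' act_aut /fold_symbol fold_target_act.
Qed.
End FoldInvariance.

(** * The energy of folding one site *)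

Section Energy.
Variables (R : realType) (V : countType) (A : finType) (G : graph V).
Variables (X : set (V -> A)) (a b : A) (N : delta X -> R).
Implicit Types (x y z : V -> A) (u v w : V) (c d : A).

Local Notation fold := (fold X a b).
Local Notation reference := (reference G X a b).
Local Notation value := (pair_value N).

Definition energy v x : R := value x (fold (pred1 v) x).

(** The contribution of the symbol [c] at the neighbour [w], relative to the
    default symbol. *)
Definition edge_energy v w c : R :=
  energy v (fun u => if u == w then c else reference v u)
  - energy v (reference v).

Definition neighbours v : {fset V} := fset_set [set w | G v w].

Lemma in_neighbours v w : (w \in neighbours v) = G v w.
Proof.
rewrite in_fset_set; last exact: adj_locally_finite.
by apply/idP/idP => [/set_mem|/mem_set].
Qed.

Hypothesis bipG : bipartite G.
Hypothesis nnX : nn_constraint_space G X.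
Hypothesis foldX : strongly_config_foldable G X a b.
Hypothesis fold_nonempty : X !=set0 -> config_fold X a !=set0.
Hypotheses (cocycleN : is_cocycle N) (markovN : is_markov G N).

Let foldP S x := @fold_in _ _ _ _ _ _ bipG nnX foldX fold_nonempty S x.

Lemma fold_eq_at S x y u : x u = y u -> fold S x u = fold S y u.
Proof. by rewrite /fold => ->. Qed.

Lemma fold1_agree v x : agree_off [fset v]%fset x (fold (pred1 v) x).
Proof. by move=> u; rewrite inE /fold inE => /negPf ->. Qed.

Lemma fold1_delta v x : X x -> delta X (x, fold (pred1 v) x).
Proof. by move=> Xx; apply: agree_off_delta (@fold1_agree v x) => //; exact: foldP. Qed.

Lemma energy_local v x y : X x -> X y -> x v = y v ->
  (forall w, G v w -> x w = y w) -> energy v x = energy v y.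
Proof.
move=> Xx Xy xyv xyn.
apply: (pair_value_local markovN _ _ _ _ (@fold1_agree v x) (@fold1_agree v y));
  rewrite //; try exact: foldP.
- by move=> u; rewrite inE => /eqP ->.
- by move=> u; rewrite inE => /eqP ->; exact: fold_eq_at.
- by move=> u w; rewrite inE => /eqP ->; exact: xyn.
Qed.

(** The cocycle relation around the square formed by [x], [y] and their folds
    at [v]. *)
Lemma energyB v x y : delta X (x, y) ->
  energy v x - energy v y =
  value x y - value (fold (pred1 v) x) (fold (pred1 v) y).
Proof.
move=> xy; have [Xx Xy _] := xy.
have dx := fold1_delta v Xx; have dy := fold1_delta v Xy.
have := pair_value_trans cocycleN xy dy.
rewrite (pair_value_trans cocycleN dx (y := fold (pred1 v) x)); last first.
  exact: delta_trans (delta_sym dx) (delta_trans xy dy).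
by rewrite /energy; lra.
Qed.

Section Hybrids.
Variables (v : V) (x : V -> A).
Hypotheses (Xx : X x) (xv : x v = a).

Let refP := referenceP bipG nnX foldX Xx xv.

(** These configurations lead from the reference configuration to one that looks
    like [x] around [v], changing the neighbours in [s] one at a time. *)
Definition hybrid (s : seq V) u := if u \in s then x u else reference v u.

Lemma hybrid_in s : {subset s <= neighbours v} -> X (hybrid s).
Proof.
have [Xref refv _ refb] := refP => sv.
have occ u : occurs X u (hybrid s u).
  by rewrite /hybrid; case: ifP => _; [exists x | exists (reference v)].
apply: (nn_constraint_glue bipG nnX) => //; first by exists x.
have half u w : G u w -> u \in s -> w \notin s ->
    occurs2 X u w (x u) (reference v w).
  move=> uw /sv; rewrite in_neighbours => vu ws.
  have [->|wv] := eqVneq w v; first by rewrite refv -xv; exact: occurs2_config.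
  rewrite (refb _ _ vu uw wv).
  have [|_ [/(_ _ uw)]] := fold_edge bipG foldX (c := x u) vu; last by [].
  by exists x.
move=> u w uw; rewrite /hybrid; have wu : G w u by rewrite adj_sym.
case: ifPn => us; case: ifPn => ws; try exact: occurs2_config; try exact: half.
exact/occurs2C/half.
Qed.

(** Changing one further neighbour [w] has the same effect whatever was changed
    before: by [energyB] and the Markov property the increment depends only on
    the symbols at [w] and at the neighbours of [w], and the latter are not
    neighbours of [v]. *)
Lemma energy_hybrid s : uniq s -> {subset s <= neighbours v} ->
  energy v (hybrid s) =
  energy v (reference v) + \sum_(w <- s) edge_energy v w (x w).
Proof.
have [Xref refv _ _] := refP.
elim: s => [_ _|w s IH /andP[ws us] sv]; first by rewrite big_nil addr0.
have sv' : {subset s <= neighbours v} by move=> u us'; apply: sv; rewrite inE us' orbT.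
have wv : G v w by rewrite -in_neighbours; apply: sv; rewrite mem_head.
have sv1 : {subset [:: w] <= neighbours v}.
  by move=> u; rewrite inE in_neighbours => /eqP ->.
have Xs := hybrid_in sv'; have Xws := hybrid_in sv; have Xw := hybrid_in sv1.
have Xnil : X (hybrid [::]) by exact: Xref.
rewrite big_cons addrCA -IH//.
have -> : edge_energy v w (x w) = energy v (hybrid [:: w]) - energy v (hybrid [::]).
  congr (energy v _ - energy v _); apply/funext => u.
  by rewrite /hybrid inE; case: eqP => // ->.
(* The increment at [w] is compared with the increment from the reference. *)
suff : energy v (hybrid (w :: s)) - energy v (hybrid s) =
    energy v (hybrid [:: w]) - energy v (hybrid [::]) by lra.
have off s' : agree_off [fset w]%fset (hybrid (w :: s')) (hybrid s').
  by move=> u; rewrite inE => uw; rewrite /hybrid inE (negPf uw).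
have near s' u : u = w \/ G w u -> {subset s' <= neighbours v} -> w \notin s' ->
    hybrid s' u = hybrid [::] u.
  move=> uw s'v ws'; rewrite /hybrid; case: ifP => // us'; exfalso.
  case: uw => [e|wu]; first by rewrite -e us' in ws'.
  have := s'v _ us'; rewrite in_neighbours => vu.
  by rewrite (bipartite_no_triangle bipG wv vu) in wu.
have near' u : u = w \/ G w u -> hybrid (w :: s) u = hybrid [:: w] u.
  move=> uw; rewrite {1}/hybrid inE; case: eqP => [->|/eqP uw'].
    by rewrite /hybrid mem_head.
  by rewrite -/(hybrid s u) near// /hybrid !inE (negPf uw') //.
have d := agree_off_delta Xws Xs (off s).
have d1 := agree_off_delta Xw Xnil (off [::]).
rewrite !energyB//; congr (_ - _).
- apply: (pair_value_local markovN _ _ _ _ (off s) (off [::])) => // u.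
  + by rewrite inE => /eqP ->; apply: near'; left.
  + by rewrite inE => /eqP ->; apply: near => //; left.
  + by move=> t; rewrite inE => /eqP -> wt; apply: near'; right.
- have foff s' : agree_off [fset w]%fset (fold (pred1 v) (hybrid (w :: s')))
      (fold (pred1 v) (hybrid s')).
    by move=> u /(off s'); exact: fold_eq_at.
  apply: (pair_value_local markovN _ _ _ _ (foff s) (foff [::]));
    try exact: foldP.
  + by move=> u; rewrite inE => /eqP ->; apply/fold_eq_at/near'; left.
  + by move=> u; rewrite inE => /eqP ->; apply/fold_eq_at/near => //; left.
  + by move=> u t; rewrite inE => /eqP -> wt; apply/fold_eq_at/near'; right.
Qed.

Lemma energyE :
  energy v x = energy v (reference v)
    + \sum_(w <- neighbours v) edge_energy v w (x w).
Proof.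
have [_ refv _ _] := refP.
rewrite -energy_hybrid//; apply: energy_local => //; first exact: hybrid_in.
  by rewrite /hybrid; case: ifP => _; rewrite ?refv.
by move=> w vw; rewrite /hybrid in_neighbours vw.
Qed.
End Hybrids.

(** Folding [v] then [w], or [w] then [v], leads to the same configuration, so the
    two sums of energies agree; [energyE] reduces this to the edge terms. *)
Lemma edge_energy_sym v w : G v w -> occurs2 X v w a a ->
  edge_energy w v a - edge_energy w v (fold_target X a b v) =
  edge_energy v w a - edge_energy v w (fold_target X a b w).
Proof.
move=> vw [x [Xx xv xw]].
have part s t : G s t -> x s = a -> x t = a ->
    energy s x - energy s (fold (pred1 t) x) =
    edge_energy s t a - edge_energy s t (fold_target X a b t).
  move=> st xs xt; have tNs := adj_neq st.
  have fs : fold (pred1 t) x s = a by rewrite /fold inE (negPf tNs).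
  rewrite (energyE Xx xs) (energyE (foldP (pred1 t) Xx) fs).
  have tn : t \in neighbours s by rewrite in_neighbours.
  have sumE (f : V -> R) : \sum_(w <- neighbours s) f w =
      f t + \sum_(w <- (neighbours s `\ t)%fset) f w by exact: big_fsetD1.
  rewrite opprD addrACA subrr add0r !sumE xt.
  have -> : fold (pred1 t) x t = fold_target X a b t.
    by rewrite /fold inE eqxx xt /fold_symbol eqxx.
  rewrite opprD addrACA -[RHS]addr0; congr (_ + _); apply/eqP; rewrite subr_eq0.
  apply/eqP; rewrite !big_seq; apply: eq_bigr => u; rewrite !inE => /andP[ut _].
  by rewrite /fold inE (negPf ut).
rewrite -!part//; last by rewrite adj_sym.
have comm : fold (pred1 v) (fold (pred1 w) x) = fold (pred1 w) (fold (pred1 v) x).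
  apply/funext => u; rewrite /fold !inE.
  have [->|_] := eqVneq u v; last by case: eqP.
  by rewrite (negPf (adj_neq vw)).
have dv := fold1_delta v Xx; have dw := fold1_delta w Xx.
have dvw := fold1_delta w (foldP (pred1 v) Xx).
have dwv := fold1_delta v (foldP (pred1 w) Xx).
have := pair_value_trans cocycleN dv dvw.
rewrite -comm (pair_value_trans cocycleN dw dwv) /energy comm; lra.
Qed.
End Energy.

(** * The interaction *)

Section Interaction.
Variables (R : realType) (V : countType) (A : finType) (G : graph V).
Variables (X : set (V -> A)) (a b : A) (N : delta X -> R).
Implicit Types (x y z : V -> A) (u v w : V) (c d : A).

Local Notation fold := (fold X a b).
Local Notation fold_symbol := (fold_symbol X a b).
Local Notation reference := (reference G X a b).
Local Notation energy := (energy a b N).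
Local Notation edge_energy := (edge_energy G a b N).
Local Notation Xa := (config_fold X a).

(** The share of the end [v] in the energy of an edge.  If the symbol [d] at [w] is
    not [a], then both summands equal [edge_energy v w d].  If it is [a], then the
    average of the values before and after folding [w] gives, added to the share
    of the end [w], the right increment for the folding of either end
    ([edge_energy_sym]).  Both ends being treated alike, no orientation of the
    edges, which [Gr] might not respect, has to be chosen. *)
Definition half_edge v w c d : R :=
  if c == a then 2^-1 * (edge_energy v w d + edge_energy v w (fold_symbol w d))
  else 0.

(** The symbol [a] at [v] contributes the reference energy to a pattern on the
    single site [v], and its half of the edge energy to a pattern on an edge;
    for [v] in the domain of [al] the default values of [odflt] are not used. *)
Definition site_energy (al : pattern V A) v : R :=
  (if (al v == Some a) && `[< dom al = [set v] >] then energy v (reference v) else 0)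
  + \sum_(w \in dom al `\ v) half_edge v w (odflt a (al v)) (odflt a (al w)).

Definition fold_interaction (al : language X) : R^o :=
  if `[< clique G (dom (val al)) >]
  then - \sum_(v \in dom (val al)) site_energy (val al) v else 0.

Lemma fold_interaction_nn : nearest_neighbour G fold_interaction.
Proof. by move=> al ncl; rewrite /fold_interaction; case: asboolP. Qed.

Lemma restr_at x (F : set V) v : F v -> restr x F v = Some (x v).
Proof. by move=> Fv; rewrite /restr mem_set. Qed.

Lemma clique1 v : clique G [set v].
Proof. by split=> [|u w]; rewrite ?inE//= => -> ->; rewrite eqxx. Qed.

Lemma clique2 v w : G v w -> clique G [set v; w].
Proof.
move=> vw; split=> [|s t]; first by rewrite finite_setU; split.
by rewrite !inE => -[->|->] -[->|->]; rewrite ?eqxx// adj_sym.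
Qed.

Lemma fold_interaction_site al x v : val al = restr x [set v] ->
  fold_interaction al = if x v == a then - energy v (reference v) else 0.
Proof.
move=> e; rewrite /fold_interaction e dom_restr asboolT; last exact: clique1.
rewrite fsbig_set1 /site_energy dom_restr restr_at// asboolT// andbT.
rewrite setDv fsbig_set0 addr0 (inj_eq Some_inj).
by case: ifP => //; rewrite oppr0.
Qed.

Lemma set2D v w : v != w -> [set v; w] `\ v = [set w] :> set V.
Proof.
move=> /eqP vw; apply/seteqP; split=> u /=; first by case=> -[].
by move=> ->; split; [right | move=> wv; apply: vw].
Qed.

Lemma fold_interaction_edge al x v w : G v w -> val al = restr x [set v; w] ->
  fold_interaction al =
  - (half_edge v w (x v) (x w) + half_edge w v (x w) (x v)).
Proof.
move=> vw e; rewrite /fold_interaction e dom_restr asboolT; last exact: clique2.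
have vNw := adj_neq vw; have wNv : w != v by rewrite eq_sym.
have site s t : s != t -> [set v; w] = [set s; t] ->
    site_energy (restr x [set v; w]) s = half_edge s t (x s) (x t).
  move=> st ->; rewrite /site_energy dom_restr asboolF ?andbF ?add0r; last first.
    move=> h; have : [set s; t] t by right.
    by rewrite h /= => ts; rewrite ts eqxx in st.
  by rewrite set2D// fsbig_set1 !restr_at//; [right | left].
rewrite fsbigU//=; last by move=> u [/= -> vw']; rewrite vw' eqxx in vNw.
by rewrite !fsbig_set1 (site v w)// (site w v)// setUC.
Qed.

Lemma fold_interaction0 al x F : val al = restr x F -> Xa x ->
  fold_interaction al = 0.
Proof.
move=> e [_ xa]; rewrite /fold_interaction; case: ifP => // _.
rewrite fsbig1 ?oppr0// => v; rewrite e dom_restr => Fv.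
rewrite /site_energy restr_at// (inj_eq Some_inj) (negPf (xa v)) add0r fsbig1//.
by move=> w _; rewrite /half_edge /= (negPf (xa v)).
Qed.

Hypothesis bipG : bipartite G.
Hypothesis nnX : nn_constraint_space G X.
Hypothesis foldX : strongly_config_foldable G X a b.
Hypothesis fold_nonempty : X !=set0 -> Xa !=set0.
Hypotheses (cocycleN : is_cocycle N) (markovN : is_markov G N).

Let foldP S x := @fold_in _ _ _ _ _ _ bipG nnX foldX fold_nonempty S x.

Section Invariance.
Variables (Gr : {pred Aut G}) (g : Aut G).
Hypotheses (invX : invariant_space Gr X) (gGr : g \in Gr).
Hypothesis invN : is_invariant_cocycle Gr N.

Let aut_inj : injective g := can_inj (aut_funK g).

Lemma energy_act v x : X x -> energy (g v) (act g x) = energy v x.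
Proof.
move=> Xx; rewrite /energy (@fold_act _ _ _ _ _ _ _ _ invX gGr (pred1 v)); last first.
  by move=> u; rewrite !inE (inj_eq aut_inj).
apply: (pair_value_act invX invN gGr).
exact: (fold1_delta bipG nnX foldX fold_nonempty).
Qed.

(** The reference configurations at [v] and at [g v] need not correspond under
    [g] as a whole; they do around these sites, and the energy sees no more. *)
Lemma energy_act_local v x y : X x -> X y -> x (g v) = y v ->
  (forall w, G v w -> x (g w) = y w) -> energy (g v) x = energy v y.
Proof.
move=> Xx Xy xyv xyn; rewrite -(energy_act v Xy).
apply: (energy_local bipG nnX foldX fold_nonempty markovN) => //.
- exact/(invariant_act _ invX gGr).
- by rewrite act_aut.
- move=> w; rewrite -[w](aut_invK g); move: (aut_inv g w) => u.
  by rewrite aut_adj act_aut => /xyn.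
Qed.

Let isolatingP x v := @referenceP _ _ _ _ _ _ bipG nnX foldX x v.

Lemma reference_act v w : occurs X v a -> w = v \/ G v w ->
  reference (g v) (g w) = reference v w.
Proof.
case=> x Xx xv vw; have [_ refv refn _] := isolatingP Xx xv.
have gx : X (act g x) by apply/(invariant_act _ invX gGr).
have [|_ rgv rgn _] := @isolatingP (act g x) (g v) gx; first by rewrite act_aut.
case: vw => [->|vw]; first by rewrite refv rgv.
by rewrite refn// rgn ?aut_adj// (neighbour_symbol_act _ invX gGr).
Qed.

Lemma reference_in v : occurs X v a -> X (reference v).
Proof. by case=> x Xx xv; have [] := isolatingP Xx xv. Qed.

Lemma reference_energy_act v : occurs X v a ->
  energy (g v) (reference (g v)) = energy v (reference v).
Proof.
move=> va; apply: energy_act_local; try exact: reference_in.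
- by apply: reference_in; apply/(occurs_act invX gGr).
- by apply: reference_act => //; left.
- by move=> w vw; apply: reference_act => //; right.
Qed.

Lemma reference_update v w c : G v w -> occurs2 X v w a c ->
  X (fun u => if u == w then c else reference v u).
Proof.
move=> vw [x [Xx xv xw]].
have := hybrid_in bipG nnX foldX Xx xv (s := [:: w]).
rewrite /hybrid => h; have -> : (fun u => if u == w then c else reference v u) =
    (fun u => if u \in [:: w] then x u else reference v u).
  by apply/funext => u; rewrite inE; case: eqP => // ->.
by apply: h => u; rewrite inE in_neighbours => /eqP ->.
Qed.

Lemma edge_energy_act v w c : G v w -> occurs2 X v w a c ->
  edge_energy (g v) (g w) c = edge_energy v w c.
Proof.
move=> vw vwc; have va : occurs X v a by have [x [? ? _]] := vwc; exists x.
rewrite /edge_energy reference_energy_act//; congr (_ - _).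
apply: energy_act_local.
- by apply: reference_update; rewrite ?aut_adj//; apply/(occurs2_act invX gGr).
- exact: reference_update.
- by rewrite (inj_eq aut_inj); case: ifP => // _; apply: reference_act => //; left.
- move=> u vu; rewrite (inj_eq aut_inj); case: ifP => // _.
  by apply: reference_act => //; right.
Qed.

Lemma half_edge_act v w c d : G v w -> occurs2 X v w c d ->
  half_edge (g v) (g w) c d = half_edge v w c d.
Proof.
move=> vw vwcd; rewrite /half_edge; case: eqP => // ca; rewrite ca in vwcd.
rewrite {1}/fold_symbol (fold_target_act _ _ invX gGr) -/(fold_symbol w d).
rewrite !edge_energy_act//; apply: occurs2C.
apply: (fold_symbol_occurs2 bipG foldX); first by rewrite adj_sym.
exact: occurs2C.
Qed.

Lemma clique_aut F : clique G (g @` F) <-> clique G F.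
Proof.
split=> -[fF adjF].
  split.
    apply: sub_finite_set (finite_image (aut_inv g) fF) => u Fu.
    by exists (g u); [exists u | exact: aut_funK].
  move=> u v; rewrite !inE => Fu Fv uv; rewrite -(aut_adj g); apply: adjF.
  - by rewrite inE; exists u.
  - by rewrite inE; exists v.
  - by rewrite (inj_eq aut_inj).
split; first exact: finite_image.
move=> _ _ /set_mem[u Fu <-] /set_mem[v Fv <-]; rewrite (inj_eq aut_inj) aut_adj.
by apply: adjF; rewrite inE.
Qed.

Lemma fold_interaction_act (al be : language X) : val be = act g (val al) ->
  fold_interaction be = fold_interaction al.
Proof.
move=> e; have [F _ [x Xx /esym alx]] := set_valP al.
rewrite /fold_interaction e alx act_restr !dom_restr.
have -> : `[< clique G (g @` F) >] = `[< clique G F >].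
  exact/asbool_equiv_eq/clique_aut.
case: asboolP => // -[_ clF]; congr (- _).
have bijg (Q : set V) : set_bij Q (g @` Q) g.
  by split=> [u Qu|u v _ _ /aut_inj //|//]; exists u.
rewrite (@reindex_fsbig _ _ _ _ _ g F (g @` F) _ (bijg F)).
apply: eq_fsbigr => v; rewrite inE => Fv.
have actE u : F u -> restr (act g x) (g @` F) (g u) = Some (x u).
  by move=> Fu; rewrite restr_at ?act_aut//; exists u.
rewrite /site_energy !dom_restr actE// restr_at//.
have imD : (g @` F) `\ g v = g @` (F `\ v).
  apply/seteqP; split=> [_ [[u Fu <-] /= uv]|_ [u [Fu uv] <-]].
    by exists u => //; split=> // /= e'; apply: uv; rewrite e'.
  by split=> /=; [exists u | move/aut_inj].
congr (_ + _).
  have -> : `[< g @` F = [set g v] >] = `[< F = [set v] >].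
    apply: asbool_equiv_eq; split=> [h|->]; last by rewrite image_set1.
    apply/seteqP; split=> [u Fu|_ -> //]; apply: aut_inj.
    by have : [set g v] (g u) by rewrite -h; exists u.
  rewrite (inj_eq Some_inj); case: eqP => //= xv; case: ifP => // _.
  by apply: reference_energy_act; exists x.
rewrite imD (@reindex_fsbig _ _ _ _ _ g (F `\ v) _ _ (bijg _)).
apply: eq_fsbigr => w; rewrite inE => -[/= Fw wv].
rewrite actE// restr_at//=; apply: half_edge_act; last exact: occurs2_config.
by apply: clF; rewrite ?inE// eq_sym; apply/eqP.
Qed.
End Invariance.

(** Only the clique of [v] alone and the edges at [v] change when [v] is folded;
    their terms add up to the decomposition of [energyE].  The half terms of an
    edge with [a] at both ends combine by [edge_energy_sym]. *)
Lemma gibbs_interaction_fold v x (p : delta X) : x v = a ->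
  (val p).1 = x -> (val p).2 = fold (pred1 v) x ->
  gibbs_cocycle fold_interaction p = energy v x.
Proof.
move=> xv p1 p2; have [Xx _ _] := set_valP p; rewrite p1 in Xx.
have va : occurs X v a by exists x.
set y := fold (pred1 v) x in p2.
have yv : y v = fold_target X a b v by rewrite /y /fold inE eqxx xv /fold_symbol eqxx.
have yE u : u != v -> y u = x u by move=> uv; rewrite /y /fold inE (negPf uv).
have cNa : fold_target X a b v != a.
  by have [] := fold_targetP foldX fold_nonempty va.
(* The cliques that contain [v]. *)
pose D := ([fset v] |` [fset [fset v; w] | w in neighbours G v])%fset.
have DE F : fold_interaction (restrL (delta_snd p) F)
    - fold_interaction (restrL (delta_fst p) F) != 0 -> F \in D.
  move=> nz; have clF : clique G [set` F].
    apply: contrapT => ncl; move: nz.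
    by rewrite !fold_interaction_nn ?subrr ?eqxx//= dom_restr.
  have Fv : v \in F.
    apply: contraNT nz => vF; rewrite subr_eq0; apply/eqP; congr fold_interaction.
    apply/val_inj/restr_eq => u /= uF; rewrite p1 p2; apply: yE.
    by apply: contraNneq vF => <-.
  case: (clique_bipartite bipG clF) => [F0|[s Fs]|[s [t [st Fst]]]].
  - by have : [set` F] v by []; rewrite F0.
  - apply/fset1UP; left; apply/fsetP => u; rewrite inE.
    have sv : s = v by have : [set` F] v by []; rewrite Fs.
    rewrite sv in Fs.
    by apply/idP/eqP => [uF|->//]; have : [set` F] u by []; rewrite Fs.
  - apply/fset1UP; right.
    have [w [vw Fw]] : exists w, G v w /\ [set` F] = [set v; w].
      have : [set` F] v by []; rewrite Fst => -[->|->]; first by exists t.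
      by exists s; rewrite adj_sym setUC.
    apply/imfsetP; exists w; rewrite /= ?in_neighbours//.
    apply/fsetP => u; rewrite !inE; apply/idP/orP => [uF|uvw].
      by have : [set` F] u by []; rewrite Fw => -[]->; [left|right].
    suff : [set` F] u by []; rewrite Fw.
    by case: uvw => /eqP ->; [left|right].
rewrite (gibbs_cocycleE DE) big_fsetU1 /=; last first.
  apply/negP => /imfsetP[w /=]; rewrite in_neighbours => vw /fsetP/(_ w).
  by rewrite !inE eqxx orbT eq_sym (negPf (adj_neq vw)).
rewrite big_imfset /=; last first.
  move=> s t; rewrite !in_neighbours => vs vt /fsetP/(_ s).
  by rewrite !inE eqxx orbT eq_sym (negPf (adj_neq vs)) => /esym/eqP.
rewrite (energyE bipG nnX foldX fold_nonempty cocycleN markovN Xx xv).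
congr (_ + _).
  have fset1E : [set` [fset v]%fset] = [set v].
    by apply/seteqP; split=> u /=; rewrite inE => /eqP.
  rewrite (fold_interaction_site (x := y) (v := v)) /= ?fset1E ?p2//.
  rewrite (fold_interaction_site (x := x) (v := v)) /= ?fset1E ?p1//.
  by rewrite yv (negPf cNa) xv eqxx sub0r opprK.
rewrite !big_seq; apply: eq_bigr => w; rewrite in_neighbours => vw.
have fset2E : [set` [fset v; w]%fset] = [set v; w].
  apply/seteqP; split=> u /=; rewrite !inE.
    by case/orP => /eqP; [left|right].
  by case=> ->; rewrite eqxx ?orbT.
have wNv : w != v by rewrite eq_sym (adj_neq vw).
rewrite (fold_interaction_edge (x := y) vw) /= ?fset2E ?p2//.
rewrite (fold_interaction_edge (x := x) vw) /= ?fset2E ?p1//.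
rewrite yv (yE _ wNv) xv /half_edge (negPf cNa) eqxx.
have [xw|xw] := eqVneq (x w) a; last by rewrite (fold_symbolN _ _ _ xw); lra.
have vwaa : occurs2 X v w a a by exists x.
have := edge_energy_sym bipG nnX foldX fold_nonempty cocycleN markovN vw vwaa.
rewrite xw fold_symbolN// /fold_symbol eqxx; lra.
Qed.
End Interaction.

(** * Cocycles that vanish on the fold *)

Lemma group_closedV (T : groupType) (H : {pred T}) g :
  group_closed H -> g \in H -> (g^-1)%g \in H.
Proof. by move=> [H1 HV] gH; rewrite -(mul1g (g^-1)%g); exact: HV. Qed.

Section Vanishing.
Variables (R : realType) (V : countType) (A : finType) (G : graph V).
Variables (X : set (V -> A)) (a b : A).
Implicit Types (x y z : V -> A) (u v w : V).
Hypothesis bipG : bipartite G.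
Hypothesis nnX : nn_constraint_space G X.
Hypothesis foldX : strongly_config_foldable G X a b.
Hypothesis fold_nonempty : X !=set0 -> config_fold X a !=set0.

Local Notation fold := (fold X a b).
Local Notation Xa := (config_fold X a).
Let foldP S x := @fold_in _ _ _ _ _ _ bipG nnX foldX fold_nonempty S x.

(** Both configurations are folded, one site at a time, on the sites where they
    differ and on their neighbours.  The Markov property does not distinguish the
    resulting pair from the pair of totally folded configurations, which lies
    in the fold.  Folding everything at once is no alternative: infinitely many
    sites may carry [a]. *)
Lemma cocycle_eq0 (K : delta X -> R) : is_cocycle K -> is_markov G K ->
  (forall p, Xa (val p).1 -> Xa (val p).2 -> K p = 0) ->
  (forall p v, (val p).1 v = a ->
     (val p).2 = fold (pred1 v) (val p).1 -> K p = 0) ->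
  forall p, K p = 0.
Proof.
move=> cK mK K_Xa K_fold p; set x := (val p).1; set y := (val p).2.
have foldD (s : seq V) z : X z -> delta X (z, fold [in s] z).
  move=> Xz; apply: (@agree_off_delta _ _ _ [fset u in s]%fset) => //.
    exact: foldP.
  by move=> u; rewrite inE /= => us; rewrite /fold ifN.
have Ks (s : seq V) z : X z -> pair_value K z (fold [in s] z) = 0.
  move=> Xz; elim: s => [|v s IH].
    have -> : fold [in [::]] z = z by apply/funext.
    exact: pair_value_refl.
  have Xs := foldP [in s] Xz.
  have -> : fold [in v :: s] z = fold (pred1 v) (fold [in s] z).
    apply/funext => u; rewrite /fold !inE.
    case: eqP => //= _.
    case: ifP => // us; rewrite [RHS]fold_symbolN//.
    by apply: (fold_symbol_neq foldX fold_nonempty); exists z.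
  have d := fold1_delta bipG nnX foldX fold_nonempty v Xs.
  rewrite (pair_value_trans cK (foldD s z Xz) d) IH add0r.
  rewrite (pair_value_delta K d).
  have [zv|zv] := eqVneq (fold [in s] z v) a; first exact: (K_fold _ v).
  have e : fold (pred1 v) (fold [in s] z) = fold [in s] z.
    apply/funext => u; rewrite {1}/fold inE; case: eqP => // ->.
    exact: fold_symbolN.
  by rewrite -(pair_value_delta K d) e; exact: pair_value_refl.
have xy : delta X (x, y) by rewrite -surjective_pairing; exact: set_valP.
have [Xx Xy _] := xy; have [S xyS] := delta_agree_off xy.
(* [W] contains [S] and its boundary. *)
pose W := (S `|` \bigcup_(v <- S) neighbours G v)%fset.
have near u : u \in S \/ (exists2 v, v \in S & G v u) -> u \in W.
  rewrite in_fsetU => -[->//|[v vS vu]]; apply/orP; right.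
  by apply/bigfcupP; exists v; rewrite ?vS ?in_neighbours.
have foldW z u : u \in W -> fold [in enum_fset W] z u = fold predT z u.
  by move=> uW; rewrite /fold uW.
have agree_fold Q : agree_off S (fold Q x) (fold Q y).
  by move=> u /xyS; exact: fold_eq_at.
have Wxy : pair_value K (fold [in enum_fset W] x) (fold [in enum_fset W] y) = 0.
  have -> : pair_value K (fold [in enum_fset W] x) (fold [in enum_fset W] y) =
      pair_value K (fold predT x) (fold predT y).
    apply: (pair_value_local mK _ _ _ _ (agree_fold _) (agree_fold _));
      try exact: foldP.
    - by move=> u uS; apply/foldW/near; left.
    - by move=> u uS; apply/foldW/near; left.
    - by move=> v u vS vu; apply/foldW/near; right; exists v.
  have d := agree_off_delta (foldP predT Xx) (foldP predT Xy) (agree_fold _).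
  rewrite (pair_value_delta K d).
  by apply: K_Xa; exact: (fold_all_in bipG nnX foldX fold_nonempty).
have dxy := agree_off_delta (foldP [in enum_fset W] Xx)
  (foldP [in enum_fset W] Xy) (agree_fold _).
rewrite -pair_valueE -/x -/y.
have dx := foldD W x Xx; have dy := foldD W y Xy.
rewrite (pair_value_trans cK dx (delta_trans dxy (delta_sym dy))).
rewrite (pair_value_trans cK dxy (delta_sym dy)).
by rewrite (pair_value_sym cK dy) !Ks// Wxy oppr0 !addr0.
Qed.

(** The difference of [N] and the Gibbs cocycle of [fold_interaction] satisfies the
    hypotheses of [cocycle_eq0]: on the fold the interaction vanishes, since no
    pattern contains [a] there, and the energies of single folds agree by
    [gibbs_interaction_fold]. *)
Lemma gibbs_of_fold_zero (Gr : {pred Aut G}) (N : delta X -> R^o) :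
  group_closed Gr -> invariant_space Gr X -> N \in markov_cocycles R Gr X ->
  (forall p, Xa (val p).1 -> Xa (val p).2 -> N p = 0) ->
  N \in gibbs_cocycles R Gr X.
Proof.
move=> grGr invX mN N_Xa; have /asboolP[cN maN iN] := mN.
pose W := fold_interaction G a b N.
have nnW : nearest_neighbour G W by exact: fold_interaction_nn.
have invW : invariant_interaction Gr W.
  move=> g gGr al be e.
  have gGrV := group_closedV grGr gGr.
  exact: (fold_interaction_act bipG nnX foldX fold_nonempty maN invX gGrV iN).
have gW : gibbs_cocycle W \in gibbs_cocycles R Gr X by apply/asboolP; exists W.
suff -> : N = gibbs_cocycle W by [].
have : N - gibbs_cocycle W \in markov_cocycles R Gr X.
  rewrite -scaleN1r; apply: (rpredD mN); apply: rpredZ.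
  exact: gibbs_sub_markov.
case/asboolP => cK mK _.
suff K0 p : (N - gibbs_cocycle W) p = 0.
  by apply/funext => p; have /eqP := K0 p; rewrite !fctE subr_eq0 => /eqP.
apply: cocycle_eq0 => // {p} [p p1 p2|p v p1 p2]; rewrite !fctE.
  rewrite N_Xa// sub0r /gibbs_cocycle fsbig1 ?oppr0// => F _.
  have W0 (x : X) : Xa (val x) -> W (restrL x F) = 0.
    exact: (@fold_interaction0 _ _ _ _ _ _ _ _ _ (val x) [set` F]).
  by rewrite !W0 ?subrr.
rewrite (gibbs_interaction_fold bipG nnX foldX fold_nonempty cN maN p1 erefl p2).
by rewrite /energy -p2 pair_valueE subrr.
Qed.
End Vanishing.

(** * Restriction to the fold and extension by the retraction *)

Section FoldRestriction.
Variables (R : realType) (V : countType) (A : finType) (G : graph V).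
Variables (Gr : {pred Aut G}) (X : set (V -> A)) (a b : A).
Implicit Types (x y z : V -> A) (u v w : V).
Hypothesis bipG : bipartite G.
Hypothesis nnX : nn_constraint_space G X.
Hypothesis foldX : strongly_config_foldable G X a b.
Hypothesis fold_nonempty : X !=set0 -> config_fold X a !=set0.
Hypothesis grGr : group_closed Gr.
Hypothesis invX : invariant_space Gr X.

Local Notation fold := (fold X a b).
Local Notation Xa := (config_fold X a).

Lemma delta_fold_sub (p : delta Xa) : val p \in delta X.
Proof. by apply/mem_set; have [[? _] [? _] ?] := set_valP p; split. Qed.

Definition delta_incl (p : delta Xa) : delta X := exist _ (val p) (delta_fold_sub p).

Lemma delta_retract_in (p : delta X) :
  (fold predT (val p).1, fold predT (val p).2) \in delta Xa.
Proof.
have [X1 X2 fp] := set_valP p; apply/mem_set.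
split; try exact: (fold_all_in bipG nnX foldX fold_nonempty).
apply: sub_finite_set fp => u; rewrite /diff_sites /=.
by apply: contraNN => /eqP e; apply/eqP/fold_eq_at.
Qed.

Definition delta_retract (p : delta X) : delta Xa :=
  exist (fun q => q \in delta Xa) _ (delta_retract_in p).

Lemma delta_inclK : cancel delta_incl delta_retract.
Proof.
move=> p; apply: val_inj => /=; have [[_ x1] [_ x2] _] := set_valP p.
by rewrite !fold_id// -surjective_pairing.
Qed.

Definition cocycle_restrict (M : delta X -> R^o) : delta Xa -> R^o :=
  M \o delta_incl.

Definition cocycle_extend (M : delta Xa -> R^o) : delta X -> R^o :=
  M \o delta_retract.

Lemma cocycle_extendK : cancel cocycle_extend cocycle_restrict.
Proof.
move=> M; apply/funext => p.
by rewrite /cocycle_restrict /cocycle_extend /= delta_inclK.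
Qed.

Lemma cocycle_restrict_markov M : M \in markov_cocycles R Gr X ->
  cocycle_restrict M \in markov_cocycles R Gr Xa.
Proof.
case/asboolP => cM mM iM; apply/asboolP; split.
- by move=> xy yz xz e1 e2 e3; exact: cM.
- by move=> p q e1 e2; exact: mM.
- by move=> g gGr p q e1 e2; exact: (iM g gGr (delta_incl p) (delta_incl q)).
Qed.

(** The retraction acts site by site, so that folded configurations differ only
    where the original ones do and are known wherever these are known. *)
Lemma cocycle_extend_markov M : M \in markov_cocycles R Gr Xa ->
  cocycle_extend M \in markov_cocycles R Gr X.
Proof.
case/asboolP => cM mM iM; apply/asboolP; split.
- by move=> xy yz xz e1 e2 e3; apply: cM => /=; rewrite ?e1 ?e2 ?e3.
- move=> p q /=; set P := _ `|` _; set Q := _ `|` _ => e1 e2.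
  have PQ : P = Q by rewrite -(dom_restr (val p).1 P) e1 dom_restr.
  rewrite -PQ in e1 e2.
  move/restr_eq : e1 => e1; move/restr_eq : e2 => e2.
  have [X1 X2 fp] := set_valP p; have [Y1 Y2 _] := set_valP q.
  have inXa x (Xx : X x) := fold_all_in bipG nnX foldX fold_nonempty Xx.
  rewrite /cocycle_extend /= -(pair_valueE M) -[RHS](pair_valueE M) /=.
  pose S := fset_set (diff_sites (val p)).
  have SE u : (u \in S) = ((val p).1 u != (val p).2 u).
    by rewrite in_fset_set//; apply/idP/idP => [/set_mem|/mem_set].
  have SP u : u \in S -> P u by rewrite SE => pu; left.
  apply: (pair_value_local mM (S := S)); try exact: inXa.
  - by move=> u; rewrite SE => /negPn/eqP; exact: fold_eq_at.
  - move=> u; rewrite SE => /negPn/eqP pu; apply: fold_eq_at.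
    have [Pu|Pu] := pselect (P u); first by rewrite -e1// -e2.
    by apply/eqP/negPn/negP => qu; apply: Pu; rewrite PQ; left.
  - by move=> u uS; apply/fold_eq_at/e1/SP.
  - by move=> u uS; apply/fold_eq_at/e2/SP.
  - move=> u w uS uw; apply/fold_eq_at/e1.
    have [pw|pw] := pselect (diff_sites (val p) w); [by left | right; split=> //].
    by exists u; rewrite ?(adj_sym G w)//; move: uS; rewrite SE.
- move=> g gGr p q e1 e2; apply: (iM g gGr (delta_retract p)) => /=.
    by rewrite e1 (fold_act a b invX gGr (S := predT)).
  by rewrite e2 (fold_act a b invX gGr (S := predT)).
Qed.

Lemma language_fold_sub (al : language Xa) : val al \in language X.
Proof.
by have [F fF [x [Xx _] e]] := set_valP al; apply/mem_set; exists F => //; exists x.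
Qed.

Lemma cocycle_restrict_gibbs M : M \in gibbs_cocycles R Gr X ->
  cocycle_restrict M \in gibbs_cocycles R Gr Xa.
Proof.
case/asboolP => W [nnW invW ->]; apply/asboolP.
pose incl (al : language Xa) : language X := exist _ (val al) (language_fold_sub al).
exists (W \o incl); split.
- by move=> al; exact: (nnW (incl al)).
- by move=> g gGr al be e; exact: (invW g gGr (incl al)).
apply/funext => p; apply: eq_fsbigr => F _.
by congr (W _ - W _); apply: val_inj.
Qed.

Definition fold_pattern (al : pattern V A) : pattern V A :=
  fun v => omap (fold_symbol X a b v) (al v).

Lemma fold_pattern_restr x F :
  fold_pattern (restr x F) = restr (fold predT x) F.
Proof. by apply/funext => v; rewrite /fold_pattern /restr; case: ifP. Qed.

Lemma fold_pattern_in (al : language X) : fold_pattern (val al) \in language Xa.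
Proof.
have [F fF [x Xx <-]] := set_valP al; apply/mem_set; exists F => //.
rewrite fold_pattern_restr; exists (fold predT x) => //.
exact: (fold_all_in bipG nnX foldX fold_nonempty).
Qed.

Lemma dom_fold_pattern al : dom (fold_pattern al) = dom al.
Proof.
by rewrite /dom /fold_pattern; apply/seteqP; split=> v /=; case: (al v).
Qed.

Lemma fold_pattern_act g al : g \in Gr ->
  fold_pattern (act g al) = act g (fold_pattern al).
Proof.
move=> gGr; apply/funext => u; rewrite -[u](aut_invK g).
move: (aut_inv g u) => v; rewrite /fold_pattern /act /= (aut_funK g).
congr (omap _ _); apply/funext => c.
by rewrite /fold_symbol (fold_target_act a b invX gGr).
Qed.

Lemma cocycle_extend_gibbs M : M \in gibbs_cocycles R Gr Xa ->
  cocycle_extend M \in gibbs_cocycles R Gr X.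
Proof.
case/asboolP => W [nnW invW ->]; apply/asboolP.
pose retr (al : language X) : language Xa :=
  exist (fun be => be \in language Xa) _ (fold_pattern_in al).
exists (W \o retr); split.
- by move=> al ncl; apply: (nnW (retr al)) => /=; rewrite dom_fold_pattern.
- move=> g gGr al be e; apply: (invW g gGr (retr al)) => /=.
  by rewrite e fold_pattern_act// group_closedV.
apply/funext => p; apply: eq_fsbigr => F _.
by congr (W _ - W _); apply: val_inj; rewrite /= fold_pattern_restr.
Qed.

(** A cocycle differs from the extension of its restriction by a cocycle that
    vanishes on the fold, hence by a Gibbs cocycle. *)
Lemma cocycle_restrict_gibbsE M : M \in markov_cocycles R Gr X ->
  (cocycle_restrict M \in gibbs_cocycles R Gr Xa) = (M \in gibbs_cocycles R Gr X).
Proof.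
move=> mM; apply/idP/idP => [gM|]; last exact: cocycle_restrict_gibbs.
have mE := cocycle_extend_markov (cocycle_restrict_markov mM).
rewrite -[M](subrK (cocycle_extend (cocycle_restrict M))); apply: rpredD; last first.
  exact: cocycle_extend_gibbs.
apply: (gibbs_of_fold_zero bipG nnX foldX fold_nonempty grGr invX).
  by rewrite -scaleN1r; apply: (rpredD mM); apply: rpredZ.
move=> p [_ p1] [_ p2]; apply/eqP; rewrite !fctE subr_eq0; apply/eqP; congr M.
by apply: val_inj; rewrite /= !fold_id// -surjective_pairing.
Qed.

Definition markov_restrict (M : markov_space R Gr X) : markov_space R Gr Xa :=
  exist _ (cocycle_restrict (val M)) (cocycle_restrict_markov (valP M)).

Lemma markov_restrict_linear : linear markov_restrict.
Proof. by move=> k M N; apply: val_inj. Qed.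

HB.instance Definition _ := GRing.isLinear.Build R _ _ _ markov_restrict
  markov_restrict_linear.

Lemma markov_restrict_surj M' : exists M, markov_restrict M = M'.
Proof.
exists (exist (fun M => M \in markov_cocycles R Gr X) _
  (cocycle_extend_markov (valP M'))); apply: val_inj => /=.
exact: cocycle_extendK.
Qed.

Lemma strong_config_fold_isomorphic :
  lmod_isomorphic (markov_mod_gibbs R Gr X) (markov_mod_gibbs R Gr Xa).
Proof.
apply: (quot_lmod_isomorphic (f := markov_restrict)).
  exact: markov_restrict_surj.
by move=> M; exact: cocycle_restrict_gibbsE (valP M).
Qed.
End FoldRestriction.

(* The hypothesis X !=set0 -> Xa !=set0 can only fail when some isolated vertex
   of G carries the symbol a in every point of X; it is automatic when every
   vertex of G has a neighbour. *)
Theorem corollary4p8 (R : realType) (V : countType) (G : graph V) (A : finType)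
    (Gr : {pred Aut G}) (X Xa : set (V -> A)) (a : A) :
  bipartite G ->
  group_closed Gr ->
  nn_constraint_space G X ->
  invariant_space Gr X ->
  is_strong_config_fold G X a Xa ->
  (X !=set0 -> Xa !=set0) ->
  lmod_isomorphic (markov_mod_gibbs R Gr X) (markov_mod_gibbs R Gr Xa).
Proof.
move=> bipG grGr nnX invX [[b foldX] ->] fold_nonempty.
exact: (strong_config_fold_isomorphic R bipG nnX foldX fold_nonempty grGr invX).
Qed.
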